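(* Suppose that: (a) for every $x\in\mathbb X$ and every $t>0$, $\mathbb P^x[\max_{s\in[0,t]}X_s>x]=\mathbb P^x[\min_{s\in[0,t]}X_s<x]=1$; (b) for every $x\in\mathbb X$, $\delta(t)f(X^x_t)\to 0$ as $t\to\infty$, $\mathbb P^x$-a.s.; (c) for every $x\in\mathbb X$, $\mathbb E^x\big[\sup_{t\in[0,\infty)}\delta(t)f(X_t)\big]<\infty$. Then $$R^*:=\bigcap_{R\in\mathcal E,\ R\text{ closed}}R$$ is an optimal equilibrium.
   Context: $X=(X_t)_{t\ge 0}$ is a time-homogeneous continuous strong Markov process on a probability space $(\Omega,\mathcal F,\mathbb P)$, taking values in an interval $\mathbb X\subseteq\mathbb R$. $\mathcal B(\mathbb X)$ is the collection of Borel subsets of $\mathbb X$; $\mathbb P^x,\mathbb E^x$ denote probability and expectation given $X_0=x$, and $X^x$ denotes $X$ started at $x\in\mathbb X$. The payoff function $f:\mathbb X\to[0,\infty)$ is continuous. The discount function $\delta:[0,\infty)\to(0,1]$ is non-increasing and continuous, with $\delta(0)=1$, $\delta(t)\to0$ as $t\to\infty$, and is log sub-additive: $\delta(s)\delta(t)\le\delta(s+t)$ for all $s,t>0$. For $x\in\mathbb X$, $R\in\mathcal B(\mathbb X)$: $\rho(x,R):=\inf\{t>0: X^x_t\in R\}$ ($\inf\emptyset=\infty$) and $J(x,R):=\mathbb E^x[\delta(\rho(x,R))f(X_{\rho(x,R)})]$, where on $\{\rho(x,R)=\infty\}$ the integrand is taken to be $\limsup_{t\to\infty}\delta(t)f(X^x_t)$.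 Put $S_R:=\{x: f(x)>J(x,R)\}$, $I_R:=\{x: f(x)=J(x,R)\}$, $C_R:=\{x: f(x)<J(x,R)\}$, and $\Theta(R):=S_R\cup(I_R\cap R)$. $R\in\mathcal B(\mathbb X)$ is an equilibrium if $\Theta(R)=R$; $\mathcal E$ is the set of all equilibria. $V(x,R):=\max\{f(x),J(x,R)\}$. $\hat R\in\mathcal E$ is an optimal equilibrium if $V(x,\hat R)\ge V(x,R)$ for all $x\in\mathbb X$ and all $R\in\mathcal E$. ''Closed'' means closed relative to $\mathbb X$. *)

(* Defs.v *)
From mathcomp Require Import all_boot all_order all_algebra.
From mathcomp Require Import all_classical all_reals all_analysis measurable_realfun.

Set Implicit Arguments.
Unset Strict Implicit.
Unset Printing Implicit Defensive.

Import Order.TTheory GRing.Theory Num.Theory.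
Import numFieldNormedType.Exports.

Local Open Scope classical_set_scope.
Local Open Scope ring_scope.

(* Time is a real number; every definition below only looks at times t >= 0.
   The state space is an interval I of R, and the process is given as a Markov
   family: one process X on (Omega, F) and the laws P x "given X_0 = x".
   The values P x for x outside I are irrelevant. *)

Section process.
Context d (Omega : measurableType d) (R : realType).
Variables (I : set R) (X : R -> Omega -> R) (P : R -> probability Omega R).

Definition path_sigma : set (set (R -> R)) :=
  <<s [set B | exists (t : R) (A : set R),
        [/\ 0 <= t, measurable A & B = [set p : R -> R | A (p t)]] ] >>.

Definition natural_filtration (t : R) : set (set Omega) :=
  <<s [set A | exists (s : R) (B : set R),
        [/\ 0 <= s <= t, measurable B & A = X s @^-1` B] ] >>.

Definition stopping_time (tau : Omega -> \bar R) : Prop :=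
  (forall w, (0 <= tau w)%E) /\
  (forall t : R, 0 <= t -> natural_filtration t [set w | (tau w <= t%:E)%E]).

(* the sigma-algebra F_tau of events prior to tau *)
Definition prior_event (tau : Omega -> \bar R) (A : set Omega) : Prop :=
  measurable A /\
  (forall t : R, 0 <= t ->
     natural_filtration t (A `&` [set w | (tau w <= t%:E)%E])).

(* [smp_strong_markov] is the integrated form of
     P^x[X_{tau + .} \in B | F_tau] = P^{X_tau}[X \in B]  on {tau < oo};
   the same family P appearing on the right is time-homogeneity. *)
Record strong_markov_process : Prop := {
  smp_measurable : forall t : R, 0 <= t -> measurable_fun setT (X t);
  smp_state : forall (t : R) w, 0 <= t -> I (X t w);
  smp_continuous :
    forall w, {within `[0, +oo[, continuous (fun t : R => X t w)};
  smp_start : forall x, I x -> P x [set w | X 0 w = x] = 1%E;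
  smp_kernel : forall B, path_sigma B ->
    measurable_fun I (fun x => P x [set w | B (X ^~ w)]);
  smp_strong_markov : forall x tau A B, I x ->
    stopping_time tau -> prior_event tau A -> path_sigma B ->
    P x (A `&` [set w | (tau w < +oo)%E]
           `&` [set w | B (fun s => X (fine (tau w) + s) w)]) =
    (\int[P x]_(w in A `&` [set w | (tau w < +oo)%E])
       P (X (fine (tau w)) w) [set w' | B (X ^~ w')])%E }.

End process.

Record discount_function (R : realType) (delta : R -> R) : Prop := {
  discount_range : forall t : R, 0 <= t -> 0 < delta t <= 1;
  discount_nonincreasing :
    forall s t : R, 0 <= s -> s <= t -> delta t <= delta s;
  discount_continuous : {within `[0, +oo[, continuous delta};
  discount0 : delta 0 = 1;
  discount_cvg0 : delta t @[t --> +oo] --> (0 : R);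
  discount_log_subadditive :
    forall s t : R, 0 < s -> 0 < t -> delta s * delta t <= delta (s + t) }.

Section stopping.
Context d (Omega : measurableType d) (R : realType).
Variables (I : set R) (X : R -> Omega -> R) (P : R -> probability Omega R).
Variables (delta f : R -> R).

(* ereal_inf set0 = +oo *)
Definition rho (S : set R) (w : Omega) : \bar R :=
  ereal_inf [set t%:E | t in [set t : R | 0 < t /\ S (X t w)]].

(* the case -oo never occurs, since 0 <= rho S w *)
Definition stopped_payoff (S : set R) (w : Omega) : \bar R :=
  match rho S w with
  | t%:E => (delta t * f (X t w))%:E
  | +oo => limf_esup (fun t : R => (delta t * f (X t w))%:E) (pinfty_nbhs R)
  | -oo => 0
  end%E.

(* For a Borel set S, stopped_payoff S is in general only measurable for the
   P x-completion.  The library integral of a nonnegative function is the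
   supremum of the integrals of the simple functions below it, which for such a
   function is its integral for the completed measure. *)
Definition J (x : R) (S : set R) : \bar R :=
  (\int[P x]_w stopped_payoff S w)%E.

Definition stopping_region (S : set R) : set R :=
  [set x | I x /\ ((f x)%:E > J x S)%E].

Definition indifference_region (S : set R) : set R :=
  [set x | I x /\ (f x)%:E = J x S].

Definition continuation_region (S : set R) : set R :=
  [set x | I x /\ ((f x)%:E < J x S)%E].

Definition Theta (S : set R) : set R :=
  stopping_region S `|` (indifference_region S `&` S).

Definition equilibrium (S : set R) : Prop :=
  [/\ S `<=` I, measurable S & Theta S = S].

Definition V (x : R) (S : set R) : \bar R := maxe (f x)%:E (J x S).

Definition optimal_equilibrium (S : set R) : Prop :=
  equilibrium S /\
  (forall x T, I x -> equilibrium T -> (V x T <= V x S)%E).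

Definition closed_in_state_space (S : set R) : Prop :=
  exists2 C : set R, closed C & S = I `&` C.

Definition Rstar : set R :=
  \bigcap_(S in [set S | equilibrium S /\ closed_in_state_space S]) S.

End stopping.

(* Main.v *)
Require Import Defs.
From HB Require Import structures.
From mathcomp Require Import all_boot all_order all_algebra lra.
From mathcomp Require Import all_classical all_reals all_analysis measurable_realfun.
Import Order.TTheory GRing.Theory Num.Theory.
Import numFieldNormedType.Exports.
Local Open Scope classical_set_scope.
Local Open Scope ring_scope.

Set Implicit Arguments.
Unset Strict Implicit.
Unset Printing Implicit Defensive.

(** By oscillation, the path re-enters every set [S] immediately after it enters
    the closure of [S], so almost surely [rho S] is the entry time of the closed
    set [closure S], which, unlike [rho S], is a stopping time of the raw
    filtration.  Equilibria thus reduce to closed sets [D] with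
    [f <= value _ D] on [I].

    For such a [D] and any stopping time [sigma], the strong Markov property and
    log sub-additivity show that waiting from [sigma] until the next entry into
    [D] does not decrease the expected discounted payoff.  Given a sequence of
    such sets [C k], enter [C i] and then successively [C (kappa 0)],
    [C (kappa 1)], ..., where [kappa] takes every value infinitely often.  These
    times increase to the entry time of the intersection of the [C k], and
    dominated convergence shows that the intersection is at least as good as
    every [C i].  By second countability the intersection of all such sets is a
    countable intersection. *)

(** * Entry times of continuous paths *)

Section paths.
Context {R : realType}.
Implicit Types (D : set R) (p g : R -> R) (a : \bar R) (s t : R).

(* Continuity on [0, +oo[, transported to the whole line by freezing the
   function at negative times. *)
Definition cpath p := continuous (fun t => p (Num.max 0 t)).

Lemma continuous_max0 : continuous (fun t : R => Num.max 0 t).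
Proof.
move=> t; apply: (@continuous_max _ _ (cst 0) id); first exact: cvg_cst.
exact: cvg_id.
Qed.

Lemma cpath_within g : {within `[0, +oo[, continuous g} -> cpath g.
Proof.
move=> /subspace_continuousP cg t.
have t0 : `[0, +oo[%classic (Num.max 0 t) by rewrite /= in_itv/= andbT le_max lexx.
move=> B /(cg _ t0) nB; have {}nB : \forall u \near t,
    `[0, +oo[%classic (Num.max 0 u) -> B (g (Num.max 0 u)).
  exact: continuous_max0 nB.
change (\forall u \near t, B (g (Num.max 0 u))).
apply: filterS nB => u; apply.
by rewrite /= in_itv/= andbT le_max lexx.
Qed.

Lemma cpath_shift p s : 0 <= s -> cpath p -> cpath (fun u => p (s + u)).
Proof.
move=> s0 cp t.
pose h := fun u : R => s + Num.max 0 u.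
have hE : (fun u => p (s + Num.max 0 u)) = (fun t => p (Num.max 0 t)) \o h.
  apply/funext => u /=; have hu : 0 <= h u by rewrite addr_ge0// le_max lexx.
  by rewrite (max_r hu).
rewrite hE.
have : {for t, continuous h} by apply: cvgD; [exact: cvg_cst|exact: continuous_max0].
by move=> /continuous_comp; apply; exact: cp.
Qed.

Lemma cpath_cvg p (u_ : R^nat) s : cpath p -> 0 <= s -> (forall n, 0 <= u_ n) ->
  u_ @ \oo --> s -> p (u_ n) @[n --> \oo] --> p s.
Proof.
move=> cp s0 u0 us.
have := cvg_comp _ _ us (cp s); rewrite max_r// => H.
by under eq_cvg => n do rewrite -(max_r (u0 n)).
Qed.

(** Times at or after [a] count, [a] itself included, whereas [rho] asks for strictly positive
    times; for closed [D] the infimum is then attained. The bound [a] is an extended real so that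
    entries can be iterated. *)
Definition entry a D p : \bar R :=
  ereal_inf [set t%:E | t in [set t | [/\ 0 <= t, (a <= t%:E)%E & D (p t)]]].

Lemma entry_lb a D p t : 0 <= t -> (a <= t%:E)%E -> D (p t) ->
  (entry a D p <= t%:E)%E.
Proof. by move=> t0 at_ Dt; apply: ereal_inf_lbound; exists t. Qed.

Lemma entry_ge a D p : (a <= entry a D p)%E.
Proof. by apply: le_ereal_inf_tmp => _ [t [_ ? _] <-]. Qed.

Lemma entry_ge0 a D p : (0 <= entry a D p)%E.
Proof. by apply: le_ereal_inf_tmp => _ [t [? _ _] <-]; rewrite lee_fin. Qed.

(** The admissible times form a closed set bounded below, so the infimum is one of them. *)
Lemma entry_attained a D p : closed D -> cpath p -> (entry a D p < +oo)%E ->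
  exists s, [/\ entry a D p = s%:E, 0 <= s, (a <= s%:E)%E & D (p s)].
Proof.
move=> cD cp fin.
set S := [set t | [/\ 0 <= t, (a <= t%:E)%E & D (p t)]].
have [r Sr] : S !=set0.
  by move/ereal_inf_ltP : fin => [_ [r Sr <-] _]; exists r.
have lS : has_lbound S by exists 0 => ? [].
have cS : closed S.
  have -> : S = [set t | 0 <= t] `&` (EFin @^-1` [set y | (a <= y)%E]) `&`
      ((fun t => p (Num.max 0 t)) @^-1` D).
    apply/seteqP; split=> t /=.
      by case=> t0 ? ?; do ! split => //; rewrite max_r.
    by case=> -[t0 at_]; rewrite max_r.
  apply: closedI; first apply: closedI.
  - exact: closed_ge.
  - rewrite (_ : _ @^-1` _ = ~` [set t : R | (t%:E < a)%E]).
      exact/open_closedC/open_ereal_lt.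
    by apply/seteqP; split=> t /=; rewrite leNgt => /negP.
  - by move/continuous_closedP : cp; apply.
have infS : S (inf S).
  rewrite [X in X _](_ : _ = closure S); last by apply/closure_id.
  (* [inf S] is minus the supremum of the reflected set, so adherence is proved for that supremum
     and pulled back along the opposite map. *)
  have := @closure_sup _ (-%R @` S).
  rewrite /inf => H.
  have /H{}H : [set - x | x in S] !=set0 by exists (- r), r.
  have {}H : closure [set - x | x in S] (sup [set - x | x in S]).
    by apply: H; exact/has_lb_ubN.
  move=> B /= nB.
  have : nbhs (sup [set - x | x in S]) (-%R @^-1` B).
    have /(_ B) := @oppr_continuous _ R^o (sup [set - x | x in S]).
    by apply; exact: nB.
  by move=> /H[_ [[y Sy <-]]] /=; rewrite opprK => By; exists y.
exists (inf S); case: infS => i0 ai Di; split => //.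
by rewrite /entry ereal_inf_EFin//; exists r.
Qed.

Lemma entryP a D p t : closed D -> cpath p ->
  (entry a D p <= t%:E)%E <->
  exists s, [/\ 0 <= s, s <= t, (a <= s%:E)%E & D (p s)].
Proof.
move=> cD cp; split=> [et|[s [s0 st as_ Ds]]].
  have [|s [es s0 as_ Ds]] := @entry_attained a D p cD cp.
    by rewrite (le_lt_trans et)// ltry.
  by exists s; split => //; rewrite es lee_fin in et.
by rewrite (le_trans (entry_lb s0 as_ Ds))// lee_fin.
Qed.

Lemma entry_eq a D p s : 0 <= s -> (a <= s%:E)%E -> D (p s) ->
  (forall t, 0 <= t -> (a <= t%:E)%E -> D (p t) -> s <= t) ->
  entry a D p = s%:E.
Proof.
move=> s0 as_ Ds sm; apply/eqP; rewrite eq_le entry_lb//=.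
by apply: le_ereal_inf_tmp => _ [t [t0 at_ Dt] <-]; rewrite lee_fin sm.
Qed.

Lemma entry_shift s D p u : closed D -> cpath p -> 0 <= s ->
  entry 0 D (fun v => p (s + v)) = u%:E -> entry s%:E D p = (s + u)%:E.
Proof.
move=> cD cp s0 eu.
have [|v [ev v0 _ Dv]] := @entry_attained 0 D _ cD (cpath_shift s0 cp).
  by rewrite eu ltry.
have {ev}uv : u = v by move: ev; rewrite eu => -[].
rewrite -{}uv in v0 Dv.
apply: entry_eq => //; first by rewrite addr_ge0.
  by rewrite lee_fin lerDl.
move=> t t0; rewrite lee_fin => st Dt.
have : (entry 0 D (fun v => p (s + v)%R) <= (t - s)%R%:E)%E.
  by apply: entry_lb; rewrite ?lee_fin ?subr_ge0// addrC subrK.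
by rewrite eu lee_fin lerBrDl.
Qed.

(* The countably many times at which paths are sampled in [0, t]; [t] itself is
   one of them because [D] may be hit at time [t] only. *)
Definition qtime t (r : rat) := Num.min t (Num.max 0 (ratr r)).

(** These open neighbourhoods shrink to the closure of [D]; being open, they can be detected at
    sampled times. *)
Definition fringe D n : set R :=
  [set z | exists2 y, D y & `|z - y| < n.+1%:R^-1].

Lemma qtime_itv t r : 0 <= t -> 0 <= qtime t r <= t.
Proof. by move=> t0; rewrite /qtime le_min t0 le_max lexx ge_min lexx. Qed.

Lemma open_fringe D n : open (fringe D n).
Proof.
rewrite (_ : fringe D n = \bigcup_(y in D) ball y n.+1%:R^-1).
  by apply: bigcup_open => y _; exact: ball_open.
apply/seteqP; split=> z.
  by move=> [y Dy zy]; exists y => //; rewrite /ball/= distrC.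
by move=> [y Dy]; rewrite /ball/= distrC => zy; exists y.
Qed.

(** The sample is taken at or to the right of [s], so that a constraint [a <= s] survives the
    approximation. *)
Lemma qtime_approx p t s n : cpath p -> 0 <= s -> s <= t ->
  exists r, s <= qtime t r /\ `|p (qtime t r) - p s| < n.+1%:R^-1.
Proof.
move=> cp s0 st; have [->|sNt] := eqVneq s t.
  (* Any rational beyond [t] is truncated by [qtime] to [t] itself. *)
  have /rat_in_itvoo[r] : t < t + 1 by rewrite ltrDl.
  rewrite in_itv/= => /andP[tr _]; exists r.
  rewrite /qtime min_l ?lexx; last by rewrite le_max (ltW tr) orbT.
  by rewrite subrr normr0 invr_gt0.
have {sNt}st : s < t by rewrite lt_neqAle sNt.
have e0 : 0 < (n.+1%:R^-1 : R) by rewrite invr_gt0.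
have /cvgrPdist_lt/(_ _ e0) := cp s.
rewrite max_r// => /nbhs_ballP[e /= e1 He].
have /rat_in_itvoo[r] : s < Num.min t (s + e) by rewrite lt_min st ltrDl.
rewrite in_itv/= lt_min => /and3P[sr rt re].
have r0 : 0 <= (ratr r : R) by rewrite (le_trans s0 (ltW sr)).
exists r; rewrite /qtime max_r// min_r ?(ltW rt)//; split; first exact: ltW.
rewrite distrC; have := He (ratr r); rewrite /= max_r//; apply.
by rewrite /ball/= ltr0_norm ?subr_lt0// opprB ltrBlDl.
Qed.

(** One direction samples just after the entry. For the other, samples ever closer to [D] accumulate
    in the compact interval, and the accumulation point lies in [D] because [D] is closed. *)
Lemma entry_le_countable a D p t : closed D -> cpath p -> 0 <= t ->
  (entry a D p <= t%:E)%E <->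
  (forall n, exists r, (a <= (qtime t r)%:E)%E /\ fringe D n (p (qtime t r))).
Proof.
move=> cD cp t0; split.
  move=> /entryP-/(_ cD cp)[s [s0 st as_ Ds]] n.
  have [r [sr rn]] := qtime_approx n cp s0 st.
  exists r; split; first by rewrite (le_trans as_)// lee_fin.
  by exists (p s).
move=> H; apply/entryP => //.
have /choice[q Hq] : forall n, exists q, [/\ 0 <= q, q <= t, (a <= q%:E)%E & fringe D n (p q)].
  move=> n; have [r [ar Dr]] := H n; exists (qtime t r).
  by have /andP[] := qtime_itv r t0.
(* A cluster point [s] of the times [q n] is the required entry: the bound by [a] and membership in
   [D] are closed conditions. *)
have : compact `[0, t] by exact: segment_compact.
move=> /(_ (q @ \oo)) [].
  by exists 0%N => // n _ /=; rewrite in_itv/=; case: (Hq n) => -> ->.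
move=> s [] /=; rewrite in_itv/= => /andP[s0 st] cs.
exists s; split => //.
  rewrite leNgt; apply/negP => sa.
  have : nbhs s [set y : R | (y%:E < a)%E].
    by apply: open_nbhs_nbhs; split => //; exact: open_ereal_lt.
  have : (q @ \oo) [set y : R | (a <= y%:E)%E].
    by exists 0%N => // n _ /=; case: (Hq n).
  by move=> /cs{}cs /cs[y [] /=]; rewrite leNgt => /negbTE->.
apply: contrapT => Ds.
have : nbhs (p s) (~` D) by apply: open_nbhs_nbhs; split=> //; exact: closed_openC.
move=> /nbhs_ballP[e /= e0 He].
have e20 : 0 < e / 2 by rewrite divr_gt0.
have /cvgrPdist_lt/(_ _ e20) := cp s.
rewrite max_r// => ne.
have [N _ HN] : \forall n \near \oo, (n.+1%:R^-1 : R) < e / 2.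
  exact: (near_infty_natSinv_lt (PosNum e20)).
have : (q @ \oo) [set y : R | 0 <= y /\ fringe D N (p y)].
  exists N => // n /= Nn; case: (Hq n) => q0 _ _ [z Dz zn]; split=> //.
  exists z => //; rewrite (lt_le_trans zn)// lef_pV2 ?posrE// ler_nat ltnS.
  exact: Nn.
move=> /cs/(_ ne)[y [[y0 [z Dz zy]]]] /=; rewrite max_r// => py.
apply: He Dz; rewrite /ball/= (splitr e).
rewrite (le_lt_trans (ler_distD (p y) _ _))// ltrD//.
by rewrite (lt_trans zy)// HN/=.
Qed.

End paths.

(** * Measurability of entry times and of sampled processes *)

Section measurability.
Context {R : realType}.

(** For [x >= 0], the largest multiple of 1/(n+1) that does not exceed [x]. *)
Definition grid_floor n (x : R) : R :=
  (Num.truncn (n.+1%:R * x))%:R / n.+1%:R.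

Lemma grid_floor_itv n x : 0 <= x ->
  [/\ 0 <= grid_floor n x, grid_floor n x <= x & x - grid_floor n x < n.+1%:R^-1].
Proof.
move=> x0; have n0 : 0 < n.+1%:R :> R by [].
have /truncn_itv/andP[lb ub] : 0 <= n.+1%:R * x by rewrite mulr_ge0.
rewrite /grid_floor; split; first by rewrite divr_ge0.
- by rewrite ler_pdivrMr// [x * _]mulrC.
- rewrite ltrBlDl -[X in _ + X]mul1r -mulrDl ltr_pdivlMr// natr1.
  by rewrite [x * _]mulrC.
Qed.

Lemma cvg_grid_floor x : 0 <= x -> grid_floor n x @[n --> \oo] --> x.
Proof.
move=> x0; apply/cvgrPdist_lt => e e0.
have := near_infty_natSinv_lt (PosNum e0); apply: filterS => n /= ne.
by have [_ ? ?] := grid_floor_itv n x0; rewrite ger0_norm ?subr_ge0// (lt_trans _ ne).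
Qed.

Context d (T : measurableType d).

Lemma measurable_fun_le_fin (f : T -> \bar R) :
  (forall t, measurable [set w | (f w <= t%:E)%E]) -> measurable_fun setT f.
Proof.
move=> mf; apply: (measurability _ (ErealGenOInfty.measurableE R)).
move=> _ [_ [t ->] <-]; rewrite setTI.
rewrite (_ : _ @^-1` _ = ~` [set w | (f w <= t%:E)%E]).
  exact/measurableC.
by apply/seteqP; split=> w /=; rewrite in_itv/= andbT ltNge => /negP.
Qed.

(** With the random time rounded down to a grid, the sample is a countable patchwork of the
    measurable [Z t]; path continuity recovers the original as a pointwise limit. *)
Lemma measurable_sample (Z : R -> T -> R) (s : T -> R) :
  (forall t, 0 <= t -> measurable_fun setT (Z t)) ->
  (forall w, cpath (Z ^~ w)) ->
  measurable_fun setT s -> (forall w, 0 <= s w) ->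
  measurable_fun setT (fun w => Z (s w) w).
Proof.
move=> mZ cZ ms s0.
apply: (@measurable_fun_cvg _ _ _ _ (fun n w => Z (grid_floor n (s w)) w)).
  move=> n _ B mB; rewrite setTI.
  have n0 : 0 < n.+1%:R :> R by [].
  rewrite (_ : _ @^-1` B = \bigcup_k
      (s @^-1` `[k%:R / n.+1%:R, k.+1%:R / n.+1%:R[ `&` Z (k%:R / n.+1%:R) @^-1` B)).
    apply: bigcup_measurable => k _; apply: measurableI.
      by rewrite -[X in measurable X]setTI; exact: ms.
    by rewrite -[X in measurable X]setTI; apply: mZ => //; rewrite divr_ge0.
  apply/seteqP; split=> w /=.
    move=> Bw; exists (Num.truncn (n.+1%:R * s w)) => //; split => //=.
    have /truncn_itv/andP[lb ub] : 0 <= n.+1%:R * s w by rewrite mulr_ge0.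
    by rewrite in_itv/= ler_pdivrMr// ltr_pdivlMr// [s w * _]mulrC lb.
  move=> [k _ /= []]; rewrite in_itv/= ler_pdivrMr// ltr_pdivlMr// => sk.
  by rewrite /grid_floor (@truncn_def _ _ k)// [_ * s w]mulrC.
move=> w _; apply: (@cpath_cvg _ (Z ^~ w) (fun n => grid_floor n (s w))) => //.
- by move=> n; case: (grid_floor_itv n (s0 w)).
- exact: cvg_grid_floor.
Qed.

Variable (Y : R -> T -> R).
Hypothesis mY : forall t, 0 <= t -> measurable_fun setT (Y t).
Hypothesis cY : forall w, cpath (Y ^~ w).

(** The right-hand side looks at [Y] only at times up to [t]. The formula therefore yields both the
    measurability of entry times and their stopping time property. *)
Lemma entry_le_set (tau : T -> \bar R) D t : closed D -> 0 <= t ->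
  [set w | (entry (tau w) D (Y ^~ w) <= t%:E)%E] =
  \bigcap_n \bigcup_r ([set w | (tau w <= (qtime t r)%:E)%E] `&`
    Y (qtime t r) @^-1` fringe D n).
Proof.
move=> cD t0; apply/seteqP; split=> w /=.
  move=> /entry_le_countable-/(_ cD (@cY w) t0) H n _.
  by have [r [? ?]] := H n; exists r.
move=> H; apply/entry_le_countable => // n.
by have [r _ []] := H n I; exists r.
Qed.

Lemma measurable_entry (tau : T -> \bar R) D : closed D ->
  measurable_fun setT tau ->
  measurable_fun setT (fun w => entry (tau w) D (Y ^~ w)).
Proof.
move=> cD mtau; apply: measurable_fun_le_fin => t.
have [t0|t0] := leP 0 t; last first.
  rewrite (_ : [set _ | _] = set0)//; apply/seteqP; split=> // w /=.
  by apply/negP; rewrite -ltNge (lt_le_trans _ (entry_ge0 _ _ _))// lte_fin.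
rewrite entry_le_set//; apply: bigcap_measurableType => n _.
apply: bigcupT_measurable_rat => r; apply: measurableI.
  by rewrite -[X in measurable X]setTI; exact: emeasurable_fun_infty_c.
have /andP[q0 _] := qtime_itv r t0.
rewrite -[X in measurable X]setTI; apply: mY => //.
by apply: open_measurable; exact: open_fringe.
Qed.

End measurability.

(** * The space of paths *)

Section payoff.
Context {R : realType}.
Variables (delta f : R -> R).
Implicit Types (p : R -> R) (a : \bar R).

(** Continuity of [f] along the path is a separate requirement because [f] will be an extension by
    zero from the state space, possibly discontinuous on the line. *)
Definition regular p := cpath p /\ cpath (f \o p).

(* Paths along which [f] is discontinuous are excluded: the payoff at the entry
   time is measurable only as a limit along sampled times. *)
Definition pathT := {p : R -> R | regular p}.

(** The value 0 at [+oo] is almost surely the limit superior used by [stopped_payoff], since the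
    discounted payoff vanishes at infinity. *)
Definition payoff p a : \bar R :=
  if a is t%:E then (delta t * f (p t))%:E else 0%E.

Hypothesis cdelta : cpath delta.

Lemma regular_shift p s : 0 <= s -> regular p -> regular (fun u => p (s + u)).
Proof. by move=> s0 [cp cfp]; split; [exact: cpath_shift|exact: (cpath_shift s0 cfp)]. Qed.

Lemma cpath_payoff p : regular p -> cpath (fun t => delta t * f (p t)).
Proof. by move=> [_ cfp] t; apply: cvgM; [exact: cdelta|exact: cfp]. Qed.

Hypothesis delta_ge0 : forall t, 0 <= t -> 0 <= delta t.
Hypothesis f_ge0 : forall x, 0 <= f x.

Lemma payoff_ge0 p a : (0 <= a)%E -> (0 <= payoff p a)%E.
Proof. by case: a => //= t t0; rewrite lee_fin mulr_ge0// delta_ge0. Qed.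

Hypothesis mf : measurable_fun setT f.

Lemma measurable_payoff d (T : measurableType d) (Y : R -> T -> R) (tau : T -> \bar R) :
  (forall t, 0 <= t -> measurable_fun setT (Y t)) ->
  (forall w, regular (Y ^~ w)) ->
  measurable_fun setT tau -> (forall w, 0 <= tau w)%E ->
  measurable_fun setT (fun w => payoff (Y ^~ w) (tau w)).
Proof.
move=> mY rY mtau tau0.
(* [fine] sends [+oo] to 0; the infinite case is separated below by testing [tau w < +oo]. *)
pose s w := fine (tau w).
have s0 w : 0 <= s w by rewrite fine_ge0.
have ms : measurable_fun setT s by exact: measurableT_comp.
have mZ : measurable_fun setT (fun w => delta (s w) * f (Y (s w) w)).
  apply: (measurable_sample (Z := fun t w => delta t * f (Y t w))) => //.
    move=> t t0; apply: measurable_funM; first exact: measurable_cst.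
    by apply: measurableT_comp => //; exact: mY.
  by move=> w; exact: cpath_payoff.
rewrite (_ : (fun w => payoff (Y ^~ w) (tau w)) =
    (fun w => if (tau w < +oo)%E then (delta (s w) * f (Y (s w) w))%:E else 0%E)).
  apply: measurable_fun_ifT => //.
    by apply: measurable_fun_lte => //; exact: measurable_cst.
  exact/measurable_EFinP.
apply/funext => w; move: (tau0 w); rewrite /s; case: (tau w) => //= r _.
by rewrite ltry.
Qed.

End payoff.

(** * The measurable space of regular paths *)

Section path_space.
Context {R : realType}.
Variables (f : R -> R).

Lemma regular_cst (x : R) : regular f (cst x).
Proof. by split=> t; rewrite /comp/=; exact: cvg_cst. Qed.

HB.instance Definition _ := gen_eqMixin (pathT f).
HB.instance Definition _ := gen_choiceMixin (pathT f).
HB.instance Definition _ :=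
  isPointed.Build (pathT f) (exist _ _ (regular_cst 0)).

(** The trace of the cylinder sigma-algebra on regular paths, so that each event comes from some [B]
    in [path_sigma], as the strong Markov property requires. *)
Definition path_measurable : set (set (pathT f)) :=
  [set sval @^-1` B | B in @path_sigma R].

Let path_measurable0 : path_measurable set0.
Proof. by exists set0; [exact: sigma_algebra0|rewrite preimage_set0]. Qed.

Let path_measurableC A : path_measurable A -> path_measurable (~` A).
Proof.
move=> [B mB <-]; exists (~` B); last by rewrite preimage_setC.
by rewrite -setTD; exact: sigma_algebraCD.
Qed.

Let path_measurable_bigcup (F : (set (pathT f))^nat) :
  (forall i, path_measurable (F i)) -> path_measurable (\bigcup_i F i).
Proof.
move=> mF; have /choice[B BF] : forall i, exists B, path_sigma B /\ sval @^-1` B = F i.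
  by move=> i; have [B mB <-] := mF i; exists B.
exists (\bigcup_i B i); first by apply: sigma_algebra_bigcup => i; case: (BF i).
by rewrite preimage_bigcup; apply: eq_bigcupr => i _; case: (BF i).
Qed.

HB.instance Definition _ := @isMeasurable.Build default_measure_display
  (pathT f) path_measurable path_measurable0 path_measurableC
  path_measurable_bigcup.

Lemma measurable_path_eval t : 0 <= t ->
  measurable_fun setT (fun p : pathT f => sval p t).
Proof.
move=> t0 _ B mB; rewrite setTI; exists [set p : R -> R | B (p t)] => //.
by apply: sub_sigma_algebra; exists t, B.
Qed.

(** The sets of paths with measurable preimage form a sigma-algebra containing the cylinders. *)
Lemma measurable_to_path d (T : measurableType d) (g : T -> pathT f) :
  (forall t, 0 <= t -> measurable_fun setT (fun w => sval (g w) t)) ->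
  measurable_fun setT g.
Proof.
move=> mg _ _ [B mB <-]; rewrite setTI.
pose M := image_set_system setT (fun w => sval (g w)) (@measurable _ T).
have sM : sigma_algebra setT M.
  by apply: sigma_algebra_image; exact: sigma_algebra_measurable.
suff /(_ _ mB) : @path_sigma R `<=` M by rewrite /M /image_set_system/= setTI.
apply: smallest_sub => // _ [t [A [t0 mA ->]]].
by have := mg t t0 measurableT _ mA.
Qed.

End path_space.

(** * Strong Markov property for functionals of the path *)

Section disintegration.
Local Open Scope ereal_scope.
Context {R : realType}.

Lemma ge0_integral_cvgn d (T : measurableType d) (mu : {measure set T -> \bar R})
    (D : set T) (h : (T -> \bar R)^nat) (g : T -> \bar R) :
  measurable D -> (forall n, measurable_fun D (h n)) ->
  (forall n x, D x -> 0 <= h n x) ->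
  (forall x, D x -> nondecreasing_seq (h ^~ x)) ->
  (forall x, D x -> h ^~ x @ \oo --> g x) ->
  \int[mu]_(x in D) h n x @[n --> \oo] --> \int[mu]_(x in D) g x.
Proof.
move=> mD mh h0 ndh hg.
rewrite (eq_integral (fun x => limn (h ^~ x))); last first.
  by move=> x /set_mem Dx; apply/esym/cvg_lim => //; exact: hg.
exact: cvg_monotone_convergence.
Qed.

Context d1 d2 (T1 : measurableType d1) (T2 : measurableType d2).
Variables (A : set T1) (mA : measurable A).
Variables (Q : T1 -> {measure set T2 -> \bar R}).
Hypothesis mQ : forall B, measurable B -> measurable_fun A (fun w => Q w B).
Variables (phi : T2 -> \bar R).
Hypotheses (mphi : measurable_fun setT phi) (phi0 : forall x, 0 <= phi x).

Import HBNNSimple.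

Let h := nnsfun_approx measurableT mphi.

Let mhx n (x : R) : measurable (h n @^-1` [set x]).
Proof. by rewrite -[X in measurable X]setTI; exact: measurable_funP. Qed.

Let int_h n w :
  \int[Q w]_x (h n x)%:E = \sum_(x \in range (h n)) x%:E * Q w (h n @^-1` [set x]).
Proof. by rewrite integralT_nnsfun sintegralE. Qed.

Let cvg_h w : \int[Q w]_x (h n x)%:E @[n --> \oo] --> \int[Q w]_x phi x.
Proof.
apply: ge0_integral_cvgn => //.
- by move=> n; apply/measurable_EFinP; exact: measurable_funP.
- by move=> n x _; rewrite lee_fin.
- move=> x _ m n mn; rewrite lee_fin.
  by have /lefP := nd_nnsfun_approx measurableT mphi mn; exact.
- by move=> x _; apply: cvg_nnsfun_approx.
Qed.

Let mint_h n : measurable_fun A (fun w => \int[Q w]_x (h n x)%:E).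
Proof.
under eq_fun do rewrite int_h.
apply: emeasurable_fsum => // x; apply: measurable_funeM; exact: mQ.
Qed.

Lemma measurable_integral_param : measurable_fun A (fun w => \int[Q w]_x phi x).
Proof. by apply: (emeasurable_fun_cvg _ _ mint_h) => w _; exact: cvg_h. Qed.

Variables (mu : {measure set T1 -> \bar R}) (g : T1 -> T2).
Hypothesis mg : measurable_fun setT g.
Hypothesis Qg : forall B, measurable B ->
  mu (A `&` g @^-1` B) = \int[mu]_(w in A) Q w B.

Let disintegration_h n :
  \int[mu]_(w in A) (h n (g w))%:E = \int[mu]_(w in A) \int[Q w]_x (h n x)%:E.
Proof.
have mg' B : measurable B -> measurable (g @^-1` B).
  by move=> mB; rewrite -[X in measurable X]setTI; exact: mg.
(* The values of [h n] are nonnegative, but the index [x] ranges over all reals; truncation at 0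
   makes every term nonnegative and changes nothing on the range. *)
pose c (x : R) : R := Num.max 0%R x.
have c0 x : 0 <= (c x)%:E by rewrite lee_fin /c le_max lexx.
have cE (x : R) : x \in range (h n) -> x = c x.
  by move=> /set_mem[t _ <-]; rewrite /c max_r.
under eq_integral => w _.
  rewrite fimfunE -fsumEFin//.
  rewrite (eq_fsbigr (fun x => (c x)%:E * (\1_(g @^-1` (h n @^-1` [set x])) w)%:E)).
    over.
  by move=> x xr; rewrite {1}(cE _ xr) EFinM.
under [RHS]eq_integral => w _.
  rewrite int_h (eq_fsbigr (fun x => (c x)%:E * Q w (h n @^-1` [set x]))).
    over.
  by move=> x xr; rewrite {1}(cE _ xr).
rewrite ge0_integral_fsum//; last 2 first.
  move=> x; apply: measurable_funeM; apply/measurable_EFinP.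
  by apply: measurable_indic; exact: mg'.
  by move=> x w _; rewrite mule_ge0// lee_fin.
rewrite ge0_integral_fsum//; last 2 first.
  by move=> x; apply: measurable_funeM; exact: mQ.
  by move=> x w _; rewrite mule_ge0.
apply: eq_fsbigr => x _.
rewrite ge0_integralZl//; last first.
  by apply/measurable_EFinP; apply: measurable_indic; exact: mg'.
rewrite ge0_integralZl//; last exact: mQ.
by rewrite integral_indic//; [rewrite setIC Qg|exact: mg'].
Qed.

(** [Qg] is the identity for indicators; linearity gives it for simple functions, and monotone
    convergence on both sides for [phi]. *)
Lemma ge0_integral_disintegration :
  \int[mu]_(w in A) phi (g w) = \int[mu]_(w in A) \int[Q w]_x phi x.
Proof.
have ndh x : nondecreasing_seq (fun n => (h n x)%:E).
  move=> m n mn; rewrite lee_fin.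
  by have /lefP := nd_nnsfun_approx measurableT mphi mn; exact.
have mh n : measurable_fun setT (fun x => (h n x)%:E).
  by apply/measurable_EFinP; exact: measurable_funP.
have L : \int[mu]_(w in A) (h n (g w))%:E @[n --> \oo] --> \int[mu]_(w in A) phi (g w).
  apply: ge0_integral_cvgn => //.
  - by move=> n; apply: measurable_funTS; exact: (measurableT_comp (mh n) mg).
  - by move=> n x _; rewrite lee_fin.
  - by move=> x _; apply: cvg_nnsfun_approx.
have : \int[mu]_(w in A) \int[Q w]_x (h n x)%:E @[n --> \oo] -->
    \int[mu]_(w in A) \int[Q w]_x phi x.
  apply: ge0_integral_cvgn => //.
  - by move=> n w _; apply: integral_ge0 => x _; rewrite lee_fin.
  - move=> w _ m n mn; apply: ge0_le_integral => //.
    + by move=> x _; rewrite lee_fin.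
    + by move=> x _; exact: ndh.
rewrite -(funext disintegration_h) => /cvg_lim <-//.
by apply/esym/cvg_lim.
Qed.

End disintegration.

(** * Stopping times and paths restarted at them *)

Section strong_markov.
Context {R : realType} d (Omega : measurableType d).
Variables (I : set R) (X : R -> Omega -> R) (P : R -> probability Omega R).
Variable f : R -> R.
Hypothesis mI : measurable I.
Hypothesis XM : strong_markov_process I X P.
Hypothesis rX : forall w, regular f (X ^~ w).
Implicit Types (sigma : Omega -> \bar R) (D : set R).

Let cX w : cpath (X ^~ w) := (rX w).1.

Lemma natural_filtration_le s t : s <= t ->
  natural_filtration X s `<=` natural_filtration X t.
Proof.
move=> st; apply: sub_sigma_algebra2 => A [u [B [/andP[u0 us] mB ->]]].
by exists u, B; rewrite u0 (le_trans us).
Qed.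

Lemma natural_filtration_measurable t :
  natural_filtration X t `<=` measurable.
Proof.
apply: smallest_sub; first exact: sigma_algebra_measurable.
move=> A [u [B [/andP[u0 us] mB ->]]].
by rewrite -[X in measurable X]setTI; exact: (smp_measurable XM u0).
Qed.

Lemma natural_filtrationI t A B : natural_filtration X t A ->
  natural_filtration X t B -> natural_filtration X t (A `&` B).
Proof.
pose G := [set A : set Omega | exists (s : R) (B : set R),
        [/\ 0 <= s <= t, measurable B & A = X s @^-1` B] ].
exact: (@measurableI _ (g_sigma_algebraType G)).
Qed.

Lemma stopping_time_measurable sigma :
  stopping_time X sigma -> measurable_fun setT sigma.
Proof.
move=> [s0 sF]; apply: measurable_fun_le_fin => t.
have [t0|t0] := leP 0 t; first exact: (natural_filtration_measurable (sF _ t0)).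
rewrite (_ : [set _ | _] = set0)//; apply/seteqP; split=> // w /=.
by apply/negP; rewrite -ltNge (lt_le_trans _ (s0 w))// lte_fin.
Qed.

Lemma stopping_time0 : stopping_time X (fun=> 0%E).
Proof.
split=> // t t0.
pose G := [set A : set Omega | exists (s : R) (B : set R),
        [/\ 0 <= s <= t, measurable B & A = X s @^-1` B] ].
rewrite (_ : [set _ | _] = setT); first exact: (@measurableT _ (g_sigma_algebraType G)).
by apply/seteqP; split => // w _ /=; rewrite lee_fin.
Qed.

(** Every event in the formula of [entry_le_set] is observed at a time [qtime t r <= t], and the set
    operations are countable. *)
Lemma stopping_time_entry sigma D : closed D -> stopping_time X sigma ->
  stopping_time X (fun w => entry (sigma w) D (X ^~ w)).
Proof.
move=> cD [s0 sF]; split=> [w|t t0]; first exact: entry_ge0.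
rewrite entry_le_set//.
pose G := [set A : set Omega | exists (s : R) (B : set R),
        [/\ 0 <= s <= t, measurable B & A = X s @^-1` B] ].
apply: (@bigcap_measurableType _ (g_sigma_algebraType G)) => n _.
apply: (@bigcupT_measurable_rat _ (g_sigma_algebraType G)) => r.
have /andP[q0 qt] := qtime_itv r t0.
apply: natural_filtrationI; first exact: (natural_filtration_le qt (sF _ q0)).
apply: sub_sigma_algebra; exists (qtime t r), (fringe D n).
by rewrite q0 qt; split => //; apply: open_measurable; exact: open_fringe.
Qed.

Lemma prior_event_le sigma t : stopping_time X sigma -> 0 <= t ->
  prior_event X sigma [set w | (sigma w <= t%:E)%E].
Proof.
move=> [s0 sF] t0; split; first exact: (natural_filtration_measurable (sF _ t0)).
move=> u u0; rewrite (_ : _ `&` _ = [set w | (sigma w <= (Num.min t u)%:E)%E]).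
  have m0 : 0 <= Num.min t u by rewrite le_min t0.
  have /natural_filtration_le : Num.min t u <= u by rewrite ge_min lexx orbT.
  by apply; exact: sF.
apply/seteqP; split=> w /=; rewrite EFin_min le_min.
  by move=> [-> ->].
by move=> /andP[].
Qed.

Definition path_of w : pathT f := exist _ (X ^~ w) (rX w).

Lemma measurable_path_of : measurable_fun setT path_of.
Proof. by apply: measurable_to_path => t t0; exact: (smp_measurable XM t0). Qed.

Section shifted.
Variable sigma : Omega -> \bar R.
Hypothesis stau : stopping_time X sigma.

Let sigma_ge0 w : 0 <= fine (sigma w).
Proof. by rewrite fine_ge0//; case: stau. Qed.

(** Where [sigma] is infinite, [fine] gives 0 and the path is not shifted; the strong Markov
    property is applied only where [sigma] is finite. *)
Definition shifted_path w : pathT f :=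
  exist _ (fun s => X (fine (sigma w) + s) w) (regular_shift (sigma_ge0 w) (rX w)).

Let mfine : measurable_fun setT (fun w => fine (sigma w)).
Proof. by apply: measurableT_comp => //; exact: stopping_time_measurable. Qed.

Lemma measurable_shifted_path : measurable_fun setT shifted_path.
Proof.
apply: measurable_to_path => t t0 /=.
apply: (@measurable_sample _ _ _ X (fun w => fine (sigma w) + t)) => //.
- by move=> s s0; exact: (smp_measurable XM s0).
- by apply: measurable_funD => //; exact: measurable_cst.
- by move=> w; rewrite addr_ge0.
Qed.

Let Xs w := X (fine (sigma w)) w.

Let IXs w : I (Xs w).
Proof. exact: (smp_state XM). Qed.

Let mXs : measurable_fun setT Xs.
Proof.
apply: (@measurable_sample _ _ _ X) => //.
by move=> s s0; exact: (smp_measurable XM s0).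
Qed.

Let path_mfun : {mfun Omega >-> pathT f} := HB.pack path_of
  (isMeasurableFun.Build _ _ _ _ path_of measurable_path_of).

(** The strong Markov kernel: the law of the path started afresh from the position at time
    [sigma]. *)
Let Q w : {measure set (pathT f) -> \bar R} := distribution (P (Xs w)) path_mfun.

Let mQ B : measurable B -> measurable_fun setT (fun w => Q w B).
Proof.
move=> [B' mB' <-].
apply: (@measurable_comp _ _ _ _ _ _ I (fun x => P x [set w | B' (X ^~ w)])) => //.
  by move=> _ [w _ <-]; exact: IXs.
exact: (smp_kernel XM).
Qed.

Variables (phi : pathT f -> \bar R).
Hypotheses (mphi : measurable_fun setT phi) (phi0 : forall p, (0 <= phi p)%E).

Let QE w : (\int[Q w]_p phi p = \int[P (Xs w)]_w' phi (path_of w'))%E.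
Proof. by rewrite /Q ge0_integral_distribution. Qed.

Lemma measurable_restart :
  measurable_fun setT (fun w => \int[P (Xs w)]_w' phi (path_of w'))%E.
Proof.
under eq_fun do rewrite -QE.
exact: measurable_integral_param.
Qed.

(** The strong Markov property for events is the disintegration hypothesis for the kernel [Q], which
    extends it to nonnegative functionals. *)
Lemma strong_markov_integral x A : I x -> prior_event X sigma A ->
  A `<=` [set w | sigma w < +oo]%E ->
  (\int[P x]_(w in A) phi (shifted_path w) =
   \int[P x]_(w in A) \int[P (Xs w)]_w' phi (path_of w'))%E.
Proof.
move=> Ix pA Afin.
under [RHS]eq_integral do rewrite -QE.
apply: (@ge0_integral_disintegration _ _ _ _ _ _ _ Q _ _ _ _ _ shifted_path) => //.
- exact: pA.1.
- by move=> B mB; apply: measurable_funTS; exact: mQ.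
- exact: measurable_shifted_path.
- move=> _ [B mB <-].
  have := smp_strong_markov XM Ix stau pA mB.
  by rewrite (setIidl Afin).
Qed.

End shifted.
End strong_markov.

(** * Stopping later at a good set *)

Section discount.
Context {R : realType}.
Variable delta : R -> R.
Hypothesis hdelta : discount_function delta.

Lemma discount_gt0 t : 0 <= t -> 0 < delta t.
Proof. by move=> /(discount_range hdelta)/andP[]. Qed.

Lemma discount_le1 t : 0 <= t -> delta t <= 1.
Proof. by move=> /(discount_range hdelta)/andP[]. Qed.

Lemma discount_cpath : cpath delta.
Proof. exact/cpath_within/(discount_continuous hdelta). Qed.

Lemma discountM s t : 0 <= s -> 0 <= t -> delta s * delta t <= delta (s + t).
Proof.
rewrite le_eqVlt => /predU1P[<- _|s0].
  by rewrite (discount0 hdelta) mul1r add0r.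
rewrite le_eqVlt => /predU1P[<-|t0].
  by rewrite (discount0 hdelta) mulr1 addr0.
exact: (discount_log_subadditive hdelta).
Qed.

(** The decay of [delta] bounds the superlevel set, monotonicity makes it an interval, and
    continuity includes its right end. A condition on [delta sigma] thus becomes an event
    [sigma <= t], which is prior to [sigma]. *)
Lemma discount_superlevel c : 0 < c <= 1 ->
  exists2 t, 0 <= t & forall s, 0 <= s -> (c <= delta s) = (s <= t).
Proof.
move=> /andP[c0 c1].
pose S := [set t | 0 <= t /\ c <= delta t].
have S0 : S 0 by split=> //; rewrite (discount0 hdelta).
have [M M0 SM] : exists2 M, 0 <= M & ubound S M.
  have /cvgrPdist_lt/(_ _ c0)[M [Mr HM]] := discount_cvg0 hdelta.
  exists (Num.max 0 M); first by rewrite le_max lexx.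
  move=> t [t0 ct]; rewrite leNgt; apply/negP; rewrite gt_max => /andP[_ Mt].
  have := HM _ Mt; rewrite /= sub0r normrN gtr0_norm ?discount_gt0//.
  by rewrite ltNge ct.
have supS : has_sup S by split; [exists 0|exists M].
have s0 : 0 <= sup S by apply: ub_le_sup => //; exists M.
exists (sup S) => // s s1; apply/idP/idP => [cs|ss].
  by apply: ub_le_sup; [exists M|].
apply: (le_trans _ (discount_nonincreasing hdelta s1 ss)).
(* If [delta] were below [c] at [sup S], it would be so at nearby points of [S] as well. *)
rewrite leNgt; apply/negP; rewrite -subr_gt0 => e0.
have /cvgrPdist_lt/(_ _ e0) := @discount_cpath (sup S).
rewrite max_r// => /nbhs_ballP[e /= e1 He].
have [t [t0 ct] tS] := sup_adherent e1 supS.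
have tS' : t <= sup S by apply: ub_le_sup => //; exists M.
have /He : ball (sup S) e t.
  by rewrite /ball/= ger0_norm ?subr_ge0// ltrBlDr addrC -ltrBlDr.
rewrite /= max_r// distrC => /(le_lt_trans (ler_norm _)).
by rewrite ltrD2r ltNge ct.
Qed.

(** A discrete layer-cake formula: the rounded value counts the levels (j+1)/(n+1) that [u]
    reaches. *)
Lemma grid_floorE n (u : R) : 0 <= u <= 1 ->
  grid_floor n u = \sum_(j < n.+1) n.+1%:R^-1 * (j.+1%:R / n.+1%:R <= u)%R%:R.
Proof.
move=> /andP[u0 u1]; rewrite /grid_floor mulrC -big_distrr/=; congr (_ * _).
under eq_bigr => j _ do rewrite ler_pdivrMr// [u * _]mulrC -truncn_gt_nat.
rewrite -natr_sum; congr _%:R.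
set k := Num.truncn _; have kn : (k <= n.+1)%N.
  rewrite -(ler_nat R) (le_trans (y := n.+1%:R * u))// ?truncn_le ?mulr_ge0//.
  by rewrite ler_piMr.
elim: n.+1 k kn => [|m IH] k km.
  by rewrite big_ord0; apply/eqP; rewrite -leqn0.
rewrite big_ord_recr/=; move: km; rewrite leq_eqVlt => /predU1P[->|].
  rewrite ltnSn (eq_bigr (fun=> 1%N)) ?sum1_card ?card_ord ?addn1// => i _.
  by rewrite (ltn_trans (ltn_ord i)).
by rewrite ltnS => km; rewrite -IH// ltnNge km addn0.
Qed.

End discount.

Section integral_facts.
Local Open Scope ereal_scope.
Context d (T : measurableType d) {R : realType} (mu : {measure set T -> \bar R}).

Lemma fatou_bound (h : (T -> \bar R)^nat) g C :
  (forall n, measurable_fun setT (h n)) -> (forall n x, 0 <= h n x) ->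
  (forall x, h ^~ x @ \oo --> g x) ->
  (forall n, \int[mu]_x h n x <= C) -> \int[mu]_x g x <= C.
Proof.
move=> mh h0 hg hC.
rewrite (eq_integral (fun x => limn_einf (h ^~ x))); last first.
  by move=> x _; rewrite (cvg_limn_einf_sup (hg x)).1.
apply: le_trans (fatou mu measurableT mh _) _ => //.
rewrite limn_einf_lim; apply: lime_le; first exact: is_cvg_einfs.
apply: nearW => n; apply: le_trans (hC n).
by apply: ereal_inf_lbound; exists n => /=.
Qed.

(** An inequality known on each layer passes, by linearity, to a weight that is a nonnegative
    combination of layers. *)
Lemma le_integral_layers (n : nat) (A : 'I_n -> set T) (c : 'I_n -> R)
    (g1 g2 : T -> R) :
  (forall j, measurable (A j)) -> (forall j, 0 <= c j)%R ->
  measurable_fun setT g1 -> measurable_fun setT g2 ->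
  (forall x, 0 <= g1 x)%R -> (forall x, 0 <= g2 x)%R ->
  (forall j, \int[mu]_(x in A j) (g1 x)%:E <= \int[mu]_(x in A j) (g2 x)%:E) ->
  \int[mu]_x (\sum_j c j * \1_(A j) x * g1 x)%:E <=
  \int[mu]_x (\sum_j c j * \1_(A j) x * g2 x)%:E.
Proof.
move=> mA c0 mg1 mg2 g10 g20 H.
have E (g : T -> R) : measurable_fun setT g -> (forall x, 0 <= g x)%R ->
    \int[mu]_x (\sum_j c j * \1_(A j) x * g x)%:E =
    \sum_j (c j)%:E * \int[mu]_(x in A j) (g x)%:E.
  move=> mg g0.
  under eq_integral => x _ do rewrite -sumEFin.
  rewrite ge0_integral_sum//; last 2 first.
    move=> j; apply/measurable_EFinP; apply: measurable_funM => //.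
    apply: measurable_funM; first exact: measurable_cst.
    exact: measurable_indic.
    by move=> j x _; rewrite lee_fin !mulr_ge0.
  apply: eq_bigr => j _.
  rewrite [in RHS]integral_mkcond epatch_indic -ge0_integralZl//=; last 3 first.
    apply: emeasurable_funM; first exact/measurable_EFinP.
    by apply/measurable_EFinP; exact: measurable_indic.
    by move=> x _; rewrite mule_ge0 ?lee_fin.
    by rewrite lee_fin.
  by apply: eq_integral => x _; rewrite -!EFinM -mulrA [(g x * _)%R]mulrC.
rewrite !E//; apply: lee_sum => j _.
by apply: lee_wpmul2l; [rewrite lee_fin|exact: H].
Qed.

End integral_facts.

(** * Waiting from a stopping time until the next entry *)

Section one_step.
Context {R : realType} d (Omega : measurableType d).
Variables (I : set R) (X : R -> Omega -> R) (P : R -> probability Omega R).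
Variables (delta f : R -> R).
Hypothesis mI : measurable I.
Hypothesis XM : strong_markov_process I X P.
Hypothesis rX : forall w, regular f (X ^~ w).
Hypothesis hdelta : discount_function delta.
Hypothesis f_ge0 : forall x, 0 <= f x.
Hypothesis mf : measurable_fun setT f.

Let cX w : cpath (X ^~ w) := (rX w).1.
Let cdelta := discount_cpath hdelta.
Let delta_ge0 t (t0 : 0 <= t) : 0 <= delta t := ltW (discount_gt0 hdelta t0).

(** The counterpart of [J] for entry times: stopping at time 0 is allowed, and for closed [D] the
    integrand is measurable. *)
Definition value x (D : set R) : \bar R :=
  (\int[P x]_w payoff delta f (X ^~ w) (entry 0 D (X ^~ w)))%E.

Lemma fin_payoff (p : R -> R) a : (payoff delta f p a = (fine (payoff delta f p a))%:E)%E.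
Proof. by case: a. Qed.

Lemma measurable_stopped sigma : stopping_time X sigma ->
  measurable_fun setT (fun w => payoff delta f (X ^~ w) (sigma w)).
Proof.
move=> ss; apply: measurable_payoff => //.
- by move=> t t0; exact: (smp_measurable XM t0).
- exact: (stopping_time_measurable XM ss).
- exact: ss.1.
Qed.

Let phi D (p : pathT f) := payoff delta f (sval p) (entry 0 D (sval p)).

Let phi0 D p : (0 <= phi D p)%E.
Proof. by apply: payoff_ge0 => //; exact: entry_ge0. Qed.

Let mphi D : closed D -> measurable_fun setT (phi D).
Proof.
move=> cD; apply: (@measurable_payoff _ _ _ _ _ _ _ (fun t (p : pathT f) => sval p t)) => //.
- by move=> t t0; exact: measurable_path_eval.
- by move=> p; exact: (svalP p).
- apply: (@measurable_entry _ _ _ (fun t (p : pathT f) => sval p t)) => //.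
  + by move=> t t0; exact: measurable_path_eval.
  + by move=> p; exact: (svalP p).1.
- by move=> p; exact: entry_ge0.
Qed.

(** Log sub-additivity merges the discount up to [s] and the discount over the remaining wait into
    one over the total time. If [D] is never entered after [s], the left side is 0. *)
Let shifted_le sigma (ss : stopping_time X sigma) D s w : closed D -> sigma w = s%:E ->
  delta s * fine (phi D (shifted_path rX ss w)) <=
  fine (payoff delta f (X ^~ w) (entry (sigma w) D (X ^~ w))).
Proof.
move=> cD sw; have s0 : 0 <= s by rewrite -lee_fin -sw; exact: ss.1.
have r0 : 0 <= fine (payoff delta f (X ^~ w) (entry (sigma w) D (X ^~ w))).
  by apply: fine_ge0; apply: payoff_ge0 => //; exact: entry_ge0.
rewrite /phi/= sw/= in r0 *.
have := entry_ge0 0 D (fun u => X (s + u) w).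
case eu : (entry 0 D _) => [u| |]//=; last by rewrite mulr0.
rewrite lee_fin => u0; rewrite (entry_shift cD (@cX w) s0 eu)/= mulrA.
by apply: ler_wpM2r => //; exact: discountM.
Qed.

(** The event is prior to [sigma], so the strong Markov property turns the right side into an
    integral of [value] at the current position, where [f <= value] applies. *)
Let layer_ineq sigma (ss : stopping_time X sigma) D x t : closed D -> I x -> 0 <= t ->
  (forall y, I y -> (f y)%:E <= value y D)%E ->
  (\int[P x]_(w in [set w | sigma w <= t%:E]) (f (X (fine (sigma w)) w))%:E <=
   \int[P x]_(w in [set w | sigma w <= t%:E])
      (fine (phi D (shifted_path rX ss w)))%:E)%E.
Proof.
move=> cD Ix t0 fD.
have pA := prior_event_le XM ss t0.
have Afin : [set w | sigma w <= t%:E]%E `<=` [set w | sigma w < +oo]%E.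
  by move=> w /= /le_lt_trans; apply; rewrite ltry.
under [leRHS]eq_integral do rewrite -fin_payoff.
rewrite (strong_markov_integral mI XM rX ss (mphi cD) (@phi0 D) Ix pA Afin).
have mA := pA.1.
have mXs : measurable_fun setT (fun w => X (fine (sigma w)) w).
  apply: (@measurable_sample _ _ _ X) => //.
  - by move=> s s0; exact: (smp_measurable XM s0).
  - by apply: measurableT_comp => //; exact: (stopping_time_measurable XM ss).
  - by move=> w; rewrite fine_ge0//; exact: ss.1.
apply: ge0_le_integral => //.
- by move=> w _; rewrite lee_fin.
- by apply: measurable_funTS; apply/measurable_EFinP; exact: measurableT_comp.
- by apply: measurable_funTS; apply: (measurable_restart mI XM rX ss (mphi cD)); exact: phi0.
- by move=> w _; apply: fD; apply: (smp_state XM); rewrite fine_ge0//; exact: ss.1.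
Qed.

(** [layer_ineq] compares undiscounted payoffs on the events [sigma <= t]. Weighting these events
    restores the discount [delta sigma], and [shifted_le] absorbs it into the discount at the next
    entry. *)
Lemma one_step sigma D x : stopping_time X sigma -> closed D -> I x ->
  (forall y, I y -> (f y)%:E <= value y D)%E ->
  (\int[P x]_w payoff delta f (X ^~ w) (sigma w) <=
   \int[P x]_w payoff delta f (X ^~ w) (entry (sigma w) D (X ^~ w)))%E.
Proof.
move=> ss cD Ix fD.
have s0 w : 0 <= fine (sigma w) by rewrite fine_ge0//; exact: ss.1.
(* The weight [delta sigma] is approximated from below by averages of indicators
   of superlevel sets, which are events [sigma <= t] prior to [sigma]. *)
have level n (j : 'I_n.+1) : exists t, 0 <= t /\
    forall s, 0 <= s -> (j.+1%:R / n.+1%:R <= delta s) = (s <= t).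
  have [|t t0 tE] := discount_superlevel hdelta (c := j.+1%:R / n.+1%:R).
    by rewrite divr_gt0//= ler_pdivrMr// mul1r ler_nat.
  by exists t.
pose t n j := sval (cid (level n j)).
have t0 n j : 0 <= t n j by rewrite /t; case: cid => ? [].
have tE n (j : 'I_n.+1) s : 0 <= s -> (j.+1%:R / n.+1%:R <= delta s) = (s <= t n j).
  by rewrite /t; case: cid => ? [? +]; apply.
pose A n (j : 'I_n.+1) := [set w | (sigma w <= (t n j)%:E)%E].
have mA n j : measurable (A n j) by exact: (prior_event_le XM ss (t0 n j)).1.
pose g1 w := f (X (fine (sigma w)) w).
pose g2 w := fine (phi D (shifted_path rX ss w)).
have g20 w : 0 <= g2 w by rewrite fine_ge0.
have mg1 : measurable_fun setT g1.
  apply: measurableT_comp => //; apply: (@measurable_sample _ _ _ X) => //.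
  - by move=> s s1; exact: (smp_measurable XM s1).
  - by apply: measurableT_comp => //; exact: (stopping_time_measurable XM ss).
have mg2 : measurable_fun setT g2.
  apply: measurableT_comp => //; apply: (measurableT_comp (mphi cD)).
  exact: (measurable_shifted_path XM rX ss).
(* The active layers add up to the rounded [delta sigma]; when [sigma] is infinite no layer is
   active, in agreement with the payoff 0 at infinity. *)
have AE n w (g : Omega -> R) : \sum_j n.+1%:R^-1 * \1_(A n j) w * g w =
    if (sigma w < +oo)%E then grid_floor n (delta (fine (sigma w))) * g w else 0.
  have := ss.1 w; rewrite -mulr_suml.
  case sw : (sigma w) => [s| |]//= s1.
    rewrite ltry grid_floorE; last first.
      by rewrite discount_le1// delta_ge0.
    congr (_ * _); apply: eq_bigr => j _; rewrite tE// indicE.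
    congr (_ * _%:R); apply: congr1; rewrite /A.
    by apply/idP/idP; rewrite inE/= sw lee_fin.
  rewrite big1 ?mul0r// => j _; rewrite indicE memNset ?mulr0// /A/= sw.
  by rewrite leye_eq.
(* As [n] grows the rounded weights tend to [delta sigma], so by Fatou's lemma a bound for each [n]
   suffices. *)
apply: (@fatou_bound _ _ _ _
  (fun n w => (\sum_j n.+1%:R^-1 * \1_(A n j) w * g1 w)%:E)).
- move=> n; apply/measurable_EFinP; apply: measurable_sum => j.
  apply: measurable_funM => //; apply: measurable_funM => //.
- by move=> n w; rewrite lee_fin sumr_ge0// => j _; rewrite !mulr_ge0// f_ge0.
- move=> w; rewrite (funext (fun n => congr1 EFin (AE n w g1))).
  have := ss.1 w; rewrite /g1; case: (sigma w) => [s| |]//= s1; last first.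
    exact: cvg_cst.
  rewrite ltry; apply/cvg_EFin; first exact: nearW.
  by apply: cvgMl; apply: cvg_grid_floor; exact: delta_ge0.
move=> n; apply: (@le_trans _ _
  (\int[P x]_w (\sum_j n.+1%:R^-1 * \1_(A n j) w * g2 w)%:E)%E).
  apply: le_integral_layers => //.
  - by move=> w; exact: f_ge0.
  - by move=> j; exact: layer_ineq.
apply: ge0_le_integral => //.
- by move=> w _; rewrite lee_fin sumr_ge0// => j _; rewrite !mulr_ge0.
- apply/measurable_EFinP; apply: measurable_sum => j.
  apply: measurable_funM => //; apply: measurable_funM => //.
- by apply: measurable_stopped; exact: stopping_time_entry.
- move=> w _; rewrite AE fin_payoff lee_fin.
  case: ifPn => [sfin|_]; last first.
    by apply: fine_ge0; apply: payoff_ge0 => //; exact: entry_ge0.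
  have sE : sigma w = (fine (sigma w))%:E.
    by rewrite fineK// ge0_fin_numE//; exact: ss.1.
  apply: (le_trans _ (shifted_le ss cD sE)).
  by apply: ler_wpM2r => //; case: (grid_floor_itv n (delta_ge0 (s0 w))).
Qed.

End one_step.

(** * Oscillation and hitting times *)

Section integral_without_measurability.
Local Open Scope ereal_scope.
Context d (T : measurableType d) {R : realType} (mu : {measure set T -> \bar R}).

Import HBNNSimple.

Let ae_le (g1 g2 : T -> \bar R) : (forall x, 0 <= g1 x) -> (forall x, 0 <= g2 x) ->
  {ae mu, forall x, g1 x = g2 x} -> \int[mu]_x g1 x <= \int[mu]_x g2 x.
Proof.
move=> g10 g20 [N [mN N0 NE]].
have mNC := measurableC mN.
rewrite !ge0_integralTE//; apply: ge_ereal_sup => _ [h /= hg <-].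
apply: ereal_sup_ubound; exists (mul_nnsfun h (indic_nnsfun R mNC)) => /=.
  move=> x; rewrite /mindic indicE; have [xN|xN] := boolP (x \in ~` N).
    rewrite mulr1; suff <- : g1 x = g2 x by exact: hg.
    apply: contrapT => g12; move: xN; rewrite inE; apply; exact: NE.
  by rewrite mulr0.
rewrite -!integralT_nnsfun; apply: ge0_ae_eq_integral => //.
- by apply/measurable_EFinP; exact: measurable_funP.
- by apply/measurable_EFinP; exact: measurable_funP.
- by move=> x _; rewrite lee_fin.
- by move=> x _; rewrite lee_fin.
exists N; split => // x /= Hx; apply: contrapT => xN; apply: Hx => _.
by rewrite /mindic indicE mem_set// mulr1.
Qed.

(* No measurability is needed since the integral is a supremum over simple
   functions, which can be cut off on the null set. *)
Lemma ge0_integral_ae_eq (g1 g2 : T -> \bar R) :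
  (forall x, 0 <= g1 x) -> (forall x, 0 <= g2 x) ->
  {ae mu, forall x, g1 x = g2 x} -> \int[mu]_x g1 x = \int[mu]_x g2 x.
Proof.
move=> g10 g20 g12; apply/eqP; rewrite eq_le !ae_le//.
by apply: filterS g12 => x ->.
Qed.

End integral_without_measurability.

Section limsup_infty.
Context {R : realType}.
Implicit Types g : R -> R.

Lemma limf_esup_pinfty_ge0 g : (forall t, 0 <= t -> 0 <= g t) ->
  (0 <= limf_esup (fun t => (g t)%:E) (pinfty_nbhs R))%E.
Proof.
move=> g0; rewrite limf_esupE; apply: le_ereal_inf_tmp => _ [V [M [Mr HM]] <-].
apply: (@le_trans _ _ (g (Num.max 0 M + 1))%:E).
  by rewrite lee_fin g0// addr_ge0// le_max lexx.
apply: ereal_sup_ubound; exists (Num.max 0 M + 1) => //.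
by apply: HM; rewrite ltr_pwDr// le_max lexx orbT.
Qed.

Lemma limf_esup_pinfty_eq0 g : (forall t, 0 <= t -> 0 <= g t) ->
  g t @[t --> +oo] --> (0 : R) ->
  limf_esup (fun t => (g t)%:E) (pinfty_nbhs R) = 0%E.
Proof.
move=> g0 gcvg; apply/eqP; rewrite eq_le limf_esup_pinfty_ge0// andbT.
apply/lee_addgt0Pr => e e0; rewrite add0e limf_esupE.
have /cvgrPdist_lt/(_ _ e0) Hg := gcvg.
apply: (@le_trans _ _ (ereal_sup [set (g t)%:E | t in [set t | `|0 - g t| < e]])).
  by apply: ereal_inf_lbound; exists [set t | `|0 - g t| < e].
apply: ge_ereal_sup => _ [t /= gt <-]; rewrite lee_fin.
by rewrite (le_trans (ler_norm _))// -normrN -sub0r ltW.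
Qed.

End limsup_infty.

Section oscillation.
Context {R : realType}.
Implicit Types (p : R -> R) (S D I : set R).

(** Oscillation on every initial interval, expressed through sampled times so that it is a countable
    condition on the path. *)
Definition oscillates p := forall n,
  (exists r, p 0 < p (qtime n.+1%:R^-1 r)) /\
  (exists r, p (qtime n.+1%:R^-1 r) < p 0).

Lemma sup_gt_countable p t x : cpath p -> 0 <= t ->
  x < sup [set p s | s in `[0, t]] <-> exists r, x < p (qtime t r).
Proof.
move=> cp t0; split.
  move=> /sup_gt[|y [s /= sI <-]]; first by exists (p 0), 0 => //=; rewrite in_itv/= lexx.
  rewrite -subr_gt0 => xs; move: sI; rewrite in_itv/= => /andP[s0 st].
  have [k _ Hk] := near_infty_natSinv_lt (PosNum xs).
  have [r [_ Hr]] := qtime_approx k cp s0 st; exists r.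
  have := lt_trans Hr (Hk k (leqnn k)); rewrite distrC => /(le_lt_trans (ler_norm _)) /=.
  by rewrite ltrD2l ltrN2.
move=> [r xr]; apply: (lt_le_trans xr); apply: ub_le_sup.
  (* The extreme value theorem bounds the set of values, which is what makes its real supremum an
     upper bound. *)
  have [|c _ cM] := @EVT_max _ (fun t => p (Num.max 0 t)) 0 t t0.
    exact: continuous_subspaceT.
  exists (p (Num.max 0 c)) => _ [s /= st <-].
  by have := cM _ st; rewrite (max_r (y := s))//; move: st; rewrite in_itv/= => /andP[].
by exists (qtime t r) => //=; rewrite in_itv/=; exact: qtime_itv.
Qed.

Lemma inf_lt_countable p t x : cpath p -> 0 <= t ->
  inf [set p s | s in `[0, t]] < x <-> exists r, p (qtime t r) < x.
Proof.
move=> cp t0.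
have cNp : cpath (fun t => - p t) by move=> s; apply: cvgN; exact: cp.
have -> : inf [set p s | s in `[0, t]] = - sup [set (fun t => - p t) s | s in `[0, t]].
  rewrite /inf; congr (- sup _).
  apply/seteqP; split=> y.
    by move=> [_ [s st <-] <-]; exists s.
  by move=> [s st <-]; exists (p s) => //; exists s.
rewrite ltrNl; split.
  by move=> /(sup_gt_countable _ cNp t0)[r]; rewrite ltrN2 => pr; exists r.
by move=> [r pr]; apply/(sup_gt_countable _ cNp t0); exists r; rewrite ltrN2.
Qed.

Definition hitting S p : \bar R :=
  ereal_inf [set t%:E | t in [set t : R | 0 < t /\ S (p t)]].

(** At its entry into [D] the path is at a point adherent to [S]. Oscillation makes it cover an open
    interval around that point within any short time, and this interval meets [S]. *)
Lemma hitting_entry I S D p : S `<=` D -> I `&` D `<=` closure S ->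
  closed D -> cpath p -> (forall t, 0 <= t -> I (p t)) ->
  ((entry 0 D p < +oo)%E -> oscillates (fun u => p (fine (entry 0 D p) + u))) ->
  hitting S p = entry 0 D p.
Proof.
move=> SD DS cD cp Ip osc; apply/eqP; rewrite eq_le; apply/andP; split; last first.
  apply: le_ereal_inf_tmp => _ [t [t0 /SD Dt] <-].
  by apply: entry_lb => //; rewrite ?lee_fin ltW.
have [->|] := eqVneq (entry 0 D p) +oo%E; first exact: leey.
rewrite -ltey => /[dup] fin /osc.
have [s [es s0 _ Ds]] := entry_attained cD cp fin.
rewrite es/= => {}osc.
apply/lee_addgt0Pr => e e0.
have [k _ Hk] := near_infty_natSinv_lt (PosNum e0).
have {}Hk : k.+1%:R^-1 < e by exact: (Hk k (leqnn k)).
have k0 : 0 <= k.+1%:R^-1 :> R by [].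
have [[r pr] [r' pr']] := osc k; rewrite addr0 in pr pr'.
set u := qtime _ r in pr; set v := qtime _ r' in pr'.
have /andP[u0 uk] : 0 <= u <= k.+1%:R^-1 by exact: qtime_itv.
have /andP[v0 vk] : 0 <= v <= k.+1%:R^-1 by exact: qtime_itv.
have [z [Sz /= zuv]] : (S `&` [set z | p (s + v) < z < p (s + u)]) !=set0.
  apply: (DS _ (conj (Ip _ s0) Ds)).
  have -> : [set z | p (s + v) < z < p (s + u)] = `]p (s + v), p (s + u)[%classic.
    by apply/seteqP; split => y /=; rewrite in_itv.
  apply: open_nbhs_nbhs; split; first exact: interval_open.
  by rewrite /= in_itv/= pr' pr.
pose q t := p (s + Num.max 0 t).
have cq : continuous q by exact: (cpath_shift s0 cp).
have qE t : 0 <= t -> q t = p (s + t) by move=> t0; rewrite /q max_r.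
(* The intermediate value theorem between the sampled times below and above the starting value gives
   a visit to [z]. *)
have [t tuv qt] : exists2 t, t \in `[Num.min u v, Num.max u v] & q t = z.
  apply: IVT.
  - by rewrite ge_min le_max lexx.
  - exact: continuous_subspaceT.
  - move: zuv => /andP[/ltW vz /ltW zu].
    by have [uv|uv] := leP u v; rewrite ge_min le_max !qE// vz zu ?orbT.
(* Neither [u] nor [v] is 0, because the path has left its starting value at both. *)
have t0 : 0 < t.
  move: tuv; rewrite in_itv/= => /andP[+ _]; apply: lt_le_trans.
  rewrite lt_min !lt_neqAle u0 v0 !andbT; apply/andP; split.
    by apply/eqP => u00; move: pr; rewrite -u00 addr0 ltxx.
  by apply/eqP => v00; move: pr'; rewrite -v00 addr0 ltxx.
apply: (@le_trans _ _ (s + t)%:E).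
  apply: ereal_inf_lbound; exists (s + t) => //; split; first by rewrite ltr_wpDl.
  by rewrite -qE ?ltW// qt.
rewrite -EFinD lee_fin lerD2l (le_trans _ (ltW Hk))//.
move: tuv; rewrite in_itv/= => /andP[_ /le_trans]; apply.
by rewrite ge_max uk vk.
Qed.

End oscillation.

Lemma probability1_ae d (T : measurableType d) (R : realType) (P : probability T R)
    (A : set T) : measurable A -> P A = 1%E -> {ae P, forall w, A w}.
Proof.
move=> mA PA; exists (~` A); split => //; first exact: measurableC.
by rewrite probability_setC// PA subee.
Qed.

(** * From hitting Borel sets to entering closed sets *)

Section stopped_values.
Context {R : realType} d (Omega : measurableType d).
Variables (I : set R) (X : R -> Omega -> R) (P : R -> probability Omega R).
Variables (f0 delta f : R -> R).
Hypothesis mI : measurable I.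
Hypothesis XM : strong_markov_process I X P.
Hypothesis rX : forall w, regular f (X ^~ w).
Hypothesis hdelta : discount_function delta.
Hypothesis f_ge0 : forall x, 0 <= f x.
Hypothesis f0E : forall x, I x -> f0 x = f x.
Hypothesis oscillation : forall x t : R, I x -> 0 < t ->
  P x [set w | x < sup [set X s w | s in `[0, t]]] = 1%E /\
  P x [set w | inf [set X s w | s in `[0, t]] < x] = 1%E.
Hypothesis vanishing : forall x, I x ->
  {ae P x, forall w, delta t * f0 (X t w) @[t --> +oo] --> (0 : R)}.

Let cX w : cpath (X ^~ w) := (rX w).1.
Let delta_ge0 t (t0 : 0 <= t) : 0 <= delta t := ltW (discount_gt0 hdelta t0).

Let mXq t r B : 0 <= t -> measurable B -> measurable (X (qtime t r) @^-1` B).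
Proof.
move=> t0 mB; have /andP[q0 _] := qtime_itv r t0.
by rewrite -[X in measurable X]setTI; exact: (smp_measurable XM q0).
Qed.

Lemma ae_start x : I x -> {ae P x, forall w, X 0 w = x}.
Proof.
move=> Ix; apply: probability1_ae; last exact: (smp_start XM).
by rewrite -[X in measurable X]setTI; apply: (smp_measurable XM (lexx 0) measurableT (Y := [set x])).
Qed.

(** Through countable samples the oscillation events are measurable, so probability one turns into
    an almost sure statement for all [n] at once. *)
Lemma ae_oscillates x : I x -> {ae P x, forall w, oscillates (X ^~ w)}.
Proof.
move=> Ix; apply: ae_foralln => n.
have n0 : 0 < n.+1%:R^-1 :> R by [].
have [Psup Pinf] := oscillation Ix n0.
have supE : [set w | x < sup [set X s w | s in `[0, n.+1%:R^-1]]] =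
    \bigcup_r X (qtime n.+1%:R^-1 r) @^-1` `]x, +oo[%classic.
  apply/seteqP; split=> w /=.
    move=> /(sup_gt_countable _ (@cX w) (ltW n0))[r xr].
    by exists r => //=; rewrite in_itv/= xr.
  move=> [r _ /=]; rewrite in_itv/= andbT => xr.
  by apply/(sup_gt_countable _ (@cX w) (ltW n0)); exists r.
have infE : [set w | inf [set X s w | s in `[0, n.+1%:R^-1]] < x] =
    \bigcup_r X (qtime n.+1%:R^-1 r) @^-1` `]-oo, x[%classic.
  apply/seteqP; split=> w /=.
    move=> /(inf_lt_countable _ (@cX w) (ltW n0))[r xr].
    by exists r => //=; rewrite in_itv/= xr.
  move=> [r _ /=]; rewrite in_itv/= => xr.
  by apply/(inf_lt_countable _ (@cX w) (ltW n0)); exists r.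
rewrite {}supE in Psup; rewrite {}infE in Pinf.
have msup := bigcupT_measurable_rat (fun r => mXq r (ltW n0) (measurable_itv `]x, +oo[)).
have minf := bigcupT_measurable_rat (fun r => mXq r (ltW n0) (measurable_itv `]-oo, x[)).
apply: filterS3 (ae_start Ix) (probability1_ae msup Psup) (probability1_ae minf Pinf).
move=> w /= -> [r _ /=]; rewrite in_itv/= andbT => xr [r' _ /=]; rewrite in_itv/= => xr'.
by split; [exists r|exists r'].
Qed.

Lemma measurable_oscillates : measurable [set p : pathT f | oscillates (sval p)].
Proof.
rewrite (_ : [set p | _] = \bigcap_n
  (\bigcup_r [set p : pathT f | sval p 0 < sval p (qtime n.+1%:R^-1 r)] `&`
   \bigcup_r [set p : pathT f | sval p (qtime n.+1%:R^-1 r) < sval p 0])); last first.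
  apply/seteqP; split=> p /= H n.
    by move=> _; have [[r ?] [r' ?]] := H n; split; [exists r|exists r'].
  by have [//|[r _ /= ?] [r' _ /= ?]] := H n _; split; [exists r|exists r'].
have mq t r : 0 <= t -> measurable_fun setT (fun p : pathT f => sval p (qtime t r)).
  by move=> t0; have /andP[q0 _] := qtime_itv r t0; exact: measurable_path_eval.
have m0 : measurable_fun setT (fun p : pathT f => sval p 0) by exact: measurable_path_eval.
have mlt (g h : pathT f -> R) : measurable_fun setT g -> measurable_fun setT h ->
    measurable [set p | g p < h p].
  move=> mg mh; have /(_ measurableT [set true]) := measurable_fun_ltr mg mh.
  by rewrite setTI; apply.
apply: bigcap_measurableType => n _; apply: measurableI;
  by apply: bigcupT_measurable_rat => r; apply: mlt => //; exact: mq.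
Qed.

(** The strong Markov property is applied to the indicator of non-oscillating paths, whose integral
    is 0 from every starting point of [I]. *)
Lemma ae_shifted_oscillates x sigma (ss : stopping_time X sigma) : I x ->
  {ae P x, forall w, (sigma w < +oo)%E -> oscillates (sval (shifted_path rX ss w))}.
Proof.
move=> Ix.
pose A := [set w | (sigma w < +oo)%E].
have mA : measurable A.
  rewrite -[A]setTI; apply: emeasurable_fun_infty_o => //.
  exact: (stopping_time_measurable XM ss).
have pA : prior_event X sigma A.
  split=> // t t0; rewrite setIC (setIidl _); first exact: ss.2.
  by move=> w /= /le_lt_trans; apply; rewrite ltry.
pose O := [set p : pathT f | oscillates (sval p)].
have mO : measurable (~` O) by apply: measurableC; exact: measurable_oscillates.
have mshift : measurable (shifted_path rX ss @^-1` (~` O)).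
  by rewrite -[X in measurable X]setTI; exact: (measurable_shifted_path XM rX ss).
exists (A `&` shifted_path rX ss @^-1` (~` O)); split.
- exact: measurableI.
- have := strong_markov_integral mI XM rX ss
    (phi := fun p => (\1_(~` O) p)%:E) _ _ Ix pA (fun _ => id).
  rewrite setIC -integral_indic// => ->; last 2 first.
    by apply/measurable_EFinP; exact: measurable_indic.
    by move=> p; rewrite lee_fin.
  apply: integral0_eq => w Aw.
  set y := X _ w.
  have Iy : I y by apply: (smp_state XM); rewrite fine_ge0//; exact: ss.1.
  rewrite (ae_eq_integral (cst 0%E))//=; first exact: integral0.
    apply/measurable_EFinP; apply: (measurableT_comp (f := \1_(~` O) : _ -> R)).
      exact: measurable_indic.
    exact: (measurable_path_of XM rX).
  apply: filterS (ae_oscillates Iy) => w' ow' _.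
  by rewrite indicE memNset//; apply.
- by move=> w /= /not_implyP[Aw Ow]; split.
Qed.

(** Almost surely [rho] is the entry time into [D] and the payoff at infinity is 0, so the
    integrands agree. [stopped_payoff] may fail to be measurable, hence the appeal to
    [ge0_integral_ae_eq]. Here [f] extends [f0] from [I]. *)
Lemma J_value x S D : S `<=` D -> I `&` D `<=` closure S -> closed D -> I x ->
  J X P delta f0 x S = value X P delta f x D.
Proof.
move=> SD DS cD Ix.
have g0 w t : 0 <= t -> 0 <= delta t * f0 (X t w).
  by move=> t0; rewrite mulr_ge0 ?delta_ge0// f0E//; exact: (smp_state XM).
have rho0 w : (0 <= rho X S w)%E.
  by apply: le_ereal_inf_tmp => _ [t [t0 _] <-]; rewrite lee_fin ltW.
apply: ge0_integral_ae_eq.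
- move=> w; rewrite /stopped_payoff; have := rho0 w.
  case: (rho X S w) => [t| |]//; first by rewrite !lee_fin; exact: g0.
  by move=> _; apply: limf_esup_pinfty_ge0; exact: g0.
- by move=> w; apply: payoff_ge0 => //; exact: entry_ge0.
have ss := stopping_time_entry rX cD (stopping_time0 X).
apply: filterS2 (ae_shifted_oscillates ss Ix) (vanishing Ix) => w ow vw.
have rhoE : rho X S w = entry 0 D (X ^~ w).
  apply: (hitting_entry SD DS cD (@cX w)) => // t t0; exact: (smp_state XM).
rewrite /stopped_payoff rhoE; have := entry_ge0 0 D (X ^~ w).
case: (entry 0 D (X ^~ w)) => [t| |]//= t0.
  by rewrite f0E//; exact: (smp_state XM).
by apply: limf_esup_pinfty_eq0 => //; exact: g0.
Qed.

End stopped_values.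

(** * Successive entries *)

Section successive_entries.
Context {R : realType}.
Variables (C : nat -> set R) (kappa : nat -> nat).
Hypothesis cC : forall k, closed (C k).
Hypothesis kappa_often : forall k N, exists2 n, (N <= n)%N & kappa n = k.
Implicit Types (p : R -> R).

(** An entry may coincide with the previous one, so a path that has reached all the [C k] at once
    stops advancing. *)
Fixpoint entry_seq i p n : \bar R :=
  if n is m.+1 then entry (entry_seq i p m) (C (kappa m)) p else entry 0 (C i) p.

Lemma entry_seq_ge0 i p n : (0 <= entry_seq i p n)%E.
Proof. by case: n => [|n]; exact: entry_ge0. Qed.

Lemma entry_seq_nd i p : nondecreasing_seq (entry_seq i p).
Proof. by apply/nondecreasing_seqP => n /=; exact: entry_ge. Qed.

Lemma bigcap_closed : closed (\bigcap_k C k).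
Proof. by apply: closed_bigI => k _; exact: cC. Qed.

Lemma entry_seq_le i p n : cpath p ->
  (entry_seq i p n <= entry 0 (\bigcap_k C k) p)%E.
Proof.
move=> cp; have [->|] := eqVneq (entry 0 (\bigcap_k C k) p) +oo%E; first exact: leey.
rewrite -ltey => /(entry_attained bigcap_closed cp)[s [-> s0 _ Cs]].
by elim: n => [|n IH] /=; apply: entry_lb => //; exact: Cs.
Qed.

(** Each [C k] is visited infinitely often, so by closedness it contains the limit position; the
    entries never pass the entry into the intersection, by [entry_seq_le]. *)
Lemma entry_seq_lim i p l : cpath p ->
  entry_seq i p @ \oo --> l%:E -> l%:E = entry 0 (\bigcap_k C k) p.
Proof.
move=> cp el.
have le_l n : (entry_seq i p n <= l%:E)%E.
  rewrite -(cvg_lim _ el)// (cvg_lim _ (ereal_nondecreasing_cvgn (@entry_seq_nd i p)))//.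
  by apply: ereal_sup_ubound; exists n.
have efin n : entry_seq i p n = (fine (entry_seq i p n))%:E.
  rewrite fineK// ge0_fin_numE ?entry_seq_ge0//.
  by rewrite (le_lt_trans (le_l n))// ltry.
have e0 n : 0 <= fine (entry_seq i p n) by rewrite fine_ge0// entry_seq_ge0.
have fl : fine (entry_seq i p n) @[n --> \oo] --> l by exact: fine_cvg el.
have l0 : 0 <= l by rewrite -lee_fin (le_trans (entry_seq_ge0 i p 0)).
have pl : p (fine (entry_seq i p n)) @[n --> \oo] --> p l by exact: cpath_cvg.
apply/eqP; rewrite eq_le; apply/andP; split.
  rewrite -(cvg_lim _ el)//; apply: lime_le; first by apply/cvg_ex; exists l%:E.
  by apply: nearW => n; exact: entry_seq_le.
apply: entry_lb => // k _; apply: contrapT => Ck.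
have : nbhs (p l) (~` C k).
  by apply: open_nbhs_nbhs; split=> //; exact: closed_openC.
move=> /pl[N _ HN].
have [n Nn kn] := kappa_often k N.
(* Entry number [n.+1] is the one into [C (kappa n)]. *)
apply: (HN n.+1) => /=; first exact: leqW.
have [|s [+ _ _ Cs]] := @entry_attained _ (entry_seq i p n) (C (kappa n)) p (@cC _) cp.
  by have := efin n.+1; rewrite /= => ->; exact: ltry.
by move=> -> /=; rewrite -kn.
Qed.

Variables (delta f : R -> R).
Hypothesis cdelta : cpath delta.

(** If the entries stay bounded, continuity of the discounted payoff applies. If they tend to
    infinity, the payoffs vanish, which matches the value of [payoff] at [+oo]. *)
Lemma payoff_entry_seq_cvg i p : regular f p ->
  delta t * f (p t) @[t --> +oo] --> (0 : R) ->
  payoff delta f p (entry_seq i p n) @[n --> \oo] -->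
  payoff delta f p (entry 0 (\bigcap_k C k) p).
Proof.
move=> rp van; have cp := rp.1.
have := ereal_nondecreasing_cvgn (@entry_seq_nd i p).
set L := ereal_sup _ => eL.
have L0 : (0 <= L)%E.
  by apply: le_trans (entry_seq_ge0 i p 0) _; apply: ereal_sup_ubound; exists 0%N.
have Lle : (L <= entry 0 (\bigcap_k C k) p)%E.
  by apply: ge_ereal_sup => _ [n _ <-]; exact: entry_seq_le.
have le_L n : (entry_seq i p n <= L)%E by apply: ereal_sup_ubound; exists n.
clearbody L; case: L => [l| |]// in eL L0 Lle le_L *.
  rewrite -(entry_seq_lim cp eL).
  have efin n : entry_seq i p n = (fine (entry_seq i p n))%:E.
    rewrite fineK// ge0_fin_numE ?entry_seq_ge0//.
    by rewrite (le_lt_trans (le_L n))// ltry.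
  rewrite (funext (fun n => congr1 (payoff delta f p) (efin n))) /payoff.
  apply: cvg_EFin; first exact: nearW.
  apply: (cpath_cvg (p := fun t => delta t * f (p t))) => //.
  - exact: cpath_payoff.
  - by move=> n; rewrite fine_ge0// entry_seq_ge0.
  - exact: fine_cvg eL.
move: Lle; rewrite leye_eq => /eqP ->.
rewrite [X in _ --> X](_ : _ = 0%:E)//.
rewrite (funext (fun n => @fin_payoff _ delta f p (entry_seq i p n))).
apply: cvg_EFin; first exact: nearW.
apply/cvgrPdist_lt => e e0.
have /cvgrPdist_lt/(_ _ e0)[M [_ HM]] := van.
have /cvgeyPgt/(_ M) := eL; apply: filterS => n /=.
case: (entry_seq i p n) => [t| |]//= Mt; last by rewrite subrr normr0.
by apply: HM; rewrite -lte_fin.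
Qed.

End successive_entries.

(** The product of 2^k and the odd number 2N+1 has 2-adic valuation [k] and exceeds [N]. *)
Lemma logn2_often k N : exists2 n, (N <= n)%N & logn 2 n.+1 = k.
Proof.
exists (2 ^ k * N.*2.+1).-1.
  rewrite -ltnS prednK ?muln_gt0 ?expn_gt0//.
  rewrite (leq_trans _ (leq_pmull _ _)) ?expn_gt0// ltnS -addnn leq_addr//.
rewrite prednK ?muln_gt0 ?expn_gt0// lognM ?expn_gt0// pfactorK//.
by rewrite logn_coprime ?addn0// coprime2n /= odd_double.
Qed.

(** * Optimality *)

Section optimality.
Context {R : realType} d (Omega : measurableType d).
Variables (I : set R) (X : R -> Omega -> R) (P : R -> probability Omega R).
Variables (f0 delta f : R -> R).
Hypothesis mI : measurable I.
Hypothesis XM : strong_markov_process I X P.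
Hypothesis rX : forall w, regular f (X ^~ w).
Hypothesis hdelta : discount_function delta.
Hypothesis f_ge0 : forall x, 0 <= f x.
Hypothesis mf : measurable_fun setT f.
Hypothesis f0E : forall x, I x -> f0 x = f x.
Hypothesis oscillation : forall x t : R, I x -> 0 < t ->
  P x [set w | x < sup [set X s w | s in `[0, t]]] = 1%E /\
  P x [set w | inf [set X s w | s in `[0, t]] < x] = 1%E.
Hypothesis vanishing : forall x, I x ->
  {ae P x, forall w, delta t * f0 (X t w) @[t --> +oo] --> (0 : R)}.
Hypothesis domination : forall x, I x ->
  (\int[P x]_w ereal_sup [set (delta t * f0 (X t w))%:E | t in `[0%R, +oo[]
     < +oo)%E.

Let delta_ge0 t (t0 : 0 <= t) : 0 <= delta t := ltW (discount_gt0 hdelta t0).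
Let IX t w (t0 : 0 <= t) : I (X t w) := smp_state XM w t0.

Let Z w : \bar R := ereal_sup [set (delta t * f0 (X t w))%:E | t in `[0%R, +oo[].

Let Z_ge w t : 0 <= t -> ((delta t * f (X t w))%:E <= Z w)%E.
Proof.
move=> t0; apply: ereal_sup_ubound; exists t; first by rewrite /= in_itv/= t0.
by rewrite f0E//; exact: IX.
Qed.

Let Z_ge0 w : (0 <= Z w)%E.
Proof.
apply: le_trans (Z_ge w (lexx 0)).
by rewrite lee_fin mulr_ge0// delta_ge0.
Qed.

(** By path continuity, a bound at the sampled times of every integer horizon bounds the supremum
    over all times. *)
Let measurable_Z : measurable_fun setT Z.
Proof.
apply: measurable_fun_le_fin => c.
have cp w := cpath_payoff (discount_cpath hdelta) (rX w).
rewrite (_ : [set w | _] = \bigcap_(m : nat) \bigcap_r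
    [set w | delta (qtime m%:R r) * f (X (qtime m%:R r) w) <= c]).
  apply: bigcap_measurableType => m _.
  rewrite -[X in measurable X]setCK setC_bigcap; apply: measurableC.
  apply: bigcupT_measurable_rat => r; apply: measurableC.
  have /andP[q0 _] := qtime_itv r (ler0n R m).
  rewrite -[X in measurable X]setTI.
  apply: (@measurable_fun_le _ _ _ setT _ (cst c)) => //.
  apply: measurable_funM; first exact: measurable_cst.
  by apply: measurableT_comp => //; exact: (smp_measurable XM q0).
apply/seteqP; split=> w /=.
  move=> Zc m _ r _ /=; rewrite -lee_fin; apply: le_trans Zc; apply: Z_ge.
  by have /andP[] := qtime_itv r (ler0n R m).
move=> H; apply: ge_ereal_sup => _ [t /= tI <-].
have t0 : 0 <= t by move: tI; rewrite in_itv/= andbT.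
rewrite f0E; last exact: IX.
rewrite lee_fin; apply/ler_addgt0Pr => e e0.
have [k _ ke] := near_infty_natSinv_lt (PosNum e0).
have tm : t <= (Num.truncn t).+1%:R by exact/ltW/truncnS_gt.
have [r [_ Hr]] := qtime_approx k (cp w) t0 tm.
have Hc : delta (qtime (Num.truncn t).+1%:R r) * f (X (qtime (Num.truncn t).+1%:R r) w) <= c.
  exact: H.
rewrite -lerBlDl; apply: le_trans (ltW (ke k (leqnn k))).
rewrite (le_trans _ (ltW Hr))// distrC (le_trans _ (ler_norm _))//.
by rewrite lerD2l lerN2.
Qed.

(** The closed-set form of equilibria: closures of equilibria are good, and traces on [I] of good
    sets are equilibria. On [D] itself the inequality is an equality. *)
Definition good D := closed D /\ forall y, I y -> ((f y)%:E <= value X P delta f y D)%E.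

Lemma value_in x D : I x -> closed D -> D x -> value X P delta f x D = (f x)%:E.
Proof.
move=> Ix cD Dx.
rewrite /value (ae_eq_integral (cst (f x)%:E))//.
- by rewrite integral_cst//= [X in (_ * X)%E]probability_setT mule1.
- apply: (measurable_stopped XM rX hdelta mf).
  exact: (stopping_time_entry rX cD (stopping_time0 X)).
- apply: filterS (ae_start XM Ix) => w X0 _.
  rewrite (@entry_eq _ 0 D _ 0)//=; last by rewrite X0.
  by rewrite (discount0 hdelta) mul1r X0.
Qed.

(** * Intersections of sequences of good sets *)

Section bigcap.
Variable C : nat -> set R.
Hypothesis gC : forall k, good (C k).

Let cC k : closed (C k) := (gC k).1.

Let kappa n := logn 2 n.+1.

Let sigma i n w := entry_seq C kappa i (X ^~ w) n.

Let sigma_stopping i n : stopping_time X (sigma i n).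
Proof.
elim: n => [|n IH]; last exact: stopping_time_entry.
exact: (stopping_time_entry rX (@cC i) (stopping_time0 X)).
Qed.

Let value_le_sigma i n x : I x ->
  (value X P delta f x (C i) <= \int[P x]_w payoff delta f (X ^~ w) (sigma i n w))%E.
Proof.
move=> Ix; elim: n => [|n IH]; first exact: lexx.
apply: le_trans IH _.
exact: (one_step mI XM rX hdelta f_ge0 mf (sigma_stopping i n) (@cC _) Ix (gC _).2).
Qed.

(** Along the successive entries from [C i] the expected payoff never falls below the value of
    [C i]; dominated convergence with bound [Z] carries this to the limit. *)
Lemma value_le_bigcap i x : I x ->
  (value X P delta f x (C i) <= value X P delta f x (\bigcap_k C k))%E.
Proof.
move=> Ix.
have cCs : closed (\bigcap_k C k) by exact: bigcap_closed.
have [] := @dominated_convergence _ _ _ (P x) setT measurableT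
  (fun n w => payoff delta f (X ^~ w) (sigma i n w))
  (fun w => payoff delta f (X ^~ w) (entry 0 (\bigcap_k C k) (X ^~ w))) Z.
- by move=> n; exact: (measurable_stopped XM rX hdelta mf).
- apply: (measurable_stopped XM rX hdelta mf).
  exact: (stopping_time_entry rX cCs (stopping_time0 X)).
- apply: filterS (vanishing Ix) => w vw _.
  apply: payoff_entry_seq_cvg => //.
  + exact: logn2_often.
  + exact: discount_cpath.
  + apply: cvg_trans vw; apply: near_eq_cvg; near=> t.
    by rewrite f0E//; exact: IX.
- apply/integrableP; split => //.
  under eq_integral do rewrite gee0_abs//.
  exact: domination.
- apply: aeW => w n _; rewrite gee0_abs; last first.
    by apply: payoff_ge0 => //; exact: entry_seq_ge0.
  have := entry_seq_ge0 C kappa i (X ^~ w) n; rewrite /sigma.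
  by case: entry_seq => [t| |]//= t0; apply: Z_ge.
move=> _ _ /cvge_to_ge; apply.
by apply: nearW => n; exact: value_le_sigma.
Unshelve. all: by end_near. Qed.

Lemma good_bigcap : good (\bigcap_k C k).
Proof.
split=> [|y Iy]; first exact: bigcap_closed.
by apply: le_trans (value_le_bigcap 0 Iy); exact: (gC 0).2.
Qed.

End bigcap.

Lemma good_setT : good setT.
Proof. by split=> [|y Iy]; [exact: closedT|rewrite value_in//; exact: closedT]. Qed.

(** For each rational interval missed by some good set, one such set is chosen. A point outside a
    good set has a rational neighbourhood missing it, hence is excluded by a chosen set. *)
Lemma good_countable : exists2 C : nat -> set R, (forall k, good (C k)) &
  \bigcap_k C k = \bigcap_(D in good) D.
Proof.
pose sep (q : rat * rat) D := good D /\ D `&` `]ratr q.1, ratr q.2[ = set0.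
have /choice[C HC] : forall k, exists D, good D /\
    (forall q, unpickle k = Some q -> (exists D', sep q D') -> sep q D).
  move=> k; case uk : (unpickle k) => [q|]; last first.
    by exists setT; split=> //; exact: good_setT.
  have [[D' sD']|nD'] := pselect (exists D', sep q D').
    by exists D'; split=> [|_ [<-]//]; exact: sD'.1.
  (* When no good set misses the interval, [setT] is a neutral choice. *)
  by exists setT; split=> [|_ [<-]//]; exact: good_setT.
exists C; first by move=> k; case: (HC k).
apply/seteqP; split=> x Cx; last by move=> k _; apply: Cx; case: (HC k).
move=> D gD; apply: contrapT => Dx.
have : nbhs x (~` D) by apply: open_nbhs_nbhs; split=> //; exact/closed_openC/gD.1.
move=> /nbhs_ballP[e /= e0 He].
have [a] : exists a : rat, ratr a \in `]x - e, x[ by apply: rat_in_itvoo; rewrite gtrBl.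
have [b] : exists b : rat, ratr b \in `]x, x + e[ by apply: rat_in_itvoo; rewrite ltrDl.
rewrite !in_itv/= => /andP[xb be] /andP[ea ax].
have sD : sep (a, b) D.
  split=> //; apply/seteqP; split=> // y [Dy /=].
  rewrite in_itv/= => /andP[ay yb]; apply: He Dy; rewrite /ball/= ltr_norml.
  by apply/andP; split; lra.
have [_ /(_ (a, b) (pickleK _))[|_]] := HC (pickle (a, b)); first by exists D.
move=> /seteqP[H _]; apply: (H x); split; first exact: Cx.
by rewrite /= in_itv/= ax xb.
Qed.

(** * Equilibria and good sets *)

Let value_J x S D := @J_value _ _ _ I X P f0 delta f mI XM rX hdelta f_ge0 f0E
  oscillation vanishing x S D.

(** A point outside the closure with [f > J] would belong to the stopping region, hence to [S]. *)
Lemma equilibrium_good S : equilibrium I X P delta f0 S -> good (closure S).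
Proof.
move=> [SI mS TS]; split=> [|y Iy]; first exact: closed_closure.
have [Sy|Sy] := pselect (closure S y).
  by rewrite value_in//; exact: closed_closure.
rewrite -(@value_J _ S)//; [|exact: subset_closure|exact: closed_closure].
rewrite leNgt; apply/negP => fJ; apply: Sy; apply: subset_closure.
by rewrite -TS; left; split => //; rewrite f0E.
Qed.

(** Points of [D] are indifferent, as entry is immediate there; the inequality [f <= value] leaves
    the stopping region empty. *)
Lemma good_equilibrium D : good D -> equilibrium I X P delta f0 (I `&` D).
Proof.
move=> [cD fD]; split; first by move=> x [].
  by apply: measurableI => //; exact: closed_measurable.
have JE x : I x -> J X P delta f0 x (I `&` D) = value X P delta f x D.
  by move=> Ix; apply: value_J => //; exact: subset_closure.
apply/seteqP; split=> x.
  move=> [[Ix]|[_ //]]; rewrite JE// f0E// ltNge => /negP; have := fD _ Ix.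
  by [].
by move=> [Ix Dx]; right; split=> //; split=> //; rewrite JE// value_in// f0E.
Qed.

Lemma Rstar_good : Rstar I X P delta f0 = I `&` \bigcap_(D in good) D.
Proof.
apply/seteqP; split=> x.
  move=> Rx; split.
    (* The whole state space is a closed equilibrium, which places [x] in [I]. *)
    have := Rx (I `&` setT); case => //; split; last by exists setT; [exact: closedT|].
    exact/good_equilibrium/good_setT.
  move=> D gD; have := Rx (I `&` D); case => //; split; first exact: good_equilibrium.
  by exists D => //; exact: gD.1.
move=> [Ix Dx] S [eS [C cC SE]].
have := Dx _ (equilibrium_good eS); rewrite {}SE => clx; split => //.
have /closure_id -> := cC; move: clx; apply: closure_subset.
by move=> ? [].
Qed.

Lemma optimal_equilibrium_Rstar :
  optimal_equilibrium I X P delta f0 (Rstar I X P delta f0).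
Proof.
have [C gC CE] := good_countable.
have gR : good (\bigcap_(D in good) D) by rewrite -CE; exact: good_bigcap.
rewrite Rstar_good; split; first exact: good_equilibrium.
move=> x T Ix eT; rewrite /V.
have le_value : (J X P delta f0 x T <=
    J X P delta f0 x (I `&` \bigcap_(D in good) D))%E.
  rewrite (@value_J x T (closure T))//; [|exact: subset_closure|exact: closed_closure].
  rewrite (@value_J x _ (\bigcap_(D in good) D))//; last 2 first.
  - exact: subset_closure.
  - exact: gR.1.
  (* Prepending [closure T], a good set, leaves the intersection unchanged, so the comparison at
     index 0 is the one wanted. *)
  pose C' k := if k is k'.+1 then C k' else closure T.
  have gC' k : good (C' k) by case: k => //=; exact: equilibrium_good.
  apply: le_trans (value_le_bigcap gC' 0 Ix) _.
  rewrite (_ : \bigcap_k C' k = \bigcap_(D in good) D)//.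
  apply/seteqP; split=> y; last first.
    by move=> Dy [|k] _; apply: Dy => //=; exact: equilibrium_good.
  by rewrite -CE => C'y k _; exact: (C'y k.+1).
by rewrite ge_max !le_max lexx/= le_value orbT.
Qed.

End optimality.

Lemma continuous_within_comp_path (R : realType) (I : set R) (g p : R -> R) :
  {within I, continuous g} -> cpath p -> (forall t, 0 <= t -> I (p t)) ->
  continuous (fun t : R => g (p (Num.max 0 t))).
Proof.
move=> /subspace_continuousP cg cp Ip t B nB.
have It u : I (p (Num.max 0 u)) by apply: Ip; rewrite le_max lexx.
have {}nB : \forall u \near t, I (p (Num.max 0 u)) -> B (g (p (Num.max 0 u))).
  exact: (cp t _ (cg _ (It t) _ nB)).
change (\forall u \near t, B (g (p (Num.max 0 u)))).
by apply: filterS nB => u; apply.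
Qed.

Theorem theorem4p1 (R : realType) (d : measure_display)
    (Omega : measurableType d) (I : set R) (X : R -> Omega -> R)
    (P : R -> probability Omega R) (f delta : R -> R)
    (I_interval : is_interval I)
    (X_strong_markov : strong_markov_process I X P)
    (f_ge0 : forall x, I x -> 0 <= f x)
    (f_continuous : {within I, continuous f})
    (delta_discount : discount_function delta)
    (oscillation : forall x t : R, I x -> 0 < t ->
       P x [set w | x < sup [set X s w | s in `[0, t]]] = 1%E /\
       P x [set w | inf [set X s w | s in `[0, t]] < x] = 1%E)
    (vanishing : forall x, I x ->
       {ae P x, forall w, delta t * f (X t w) @[t --> +oo] --> (0 : R)})
    (domination : forall x, I x ->
       (\int[P x]_w ereal_sup [set (delta t * f (X t w))%:E | t in `[0%R, +oo[]
          < +oo)%E) :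
  optimal_equilibrium I X P delta f (Rstar I X P delta f).
Proof.
have mI : measurable I by exact: is_interval_measurable.
(* The extension by zero is nonnegative and measurable on the whole line; since paths stay in [I],
   it remains continuous along them. *)
pose g : R -> R := f \_ I.
have gE x : I x -> f x = g x by move=> Ix; rewrite /g patchE mem_set.
have g0 x : 0 <= g x.
  by rewrite /g patchE; case: ifPn => // /set_mem; exact: f_ge0.
have mg : measurable_fun setT g.
  apply/(measurable_restrictT _ mI); exact: subspace_continuous_measurable_fun.
have cX w : cpath (X ^~ w) by exact/cpath_within/(smp_continuous X_strong_markov).
have rX w : regular g (X ^~ w).
  split; first exact: cX.
  rewrite /cpath (_ : (fun t => _) = (fun t => f (X (Num.max 0 t) w))).
    apply: (continuous_within_comp_path f_continuous (@cX w)) => t t0.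
    exact: (smp_state X_strong_markov).
  apply/funext => t /=; rewrite gE//; apply: (smp_state X_strong_markov).
  by rewrite le_max lexx.
exact: (optimal_equilibrium_Rstar mI X_strong_markov rX).
Qed.
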